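(* Let $W$ be a finite Coxeter group and $c$ a Coxeter element of $W$. The map $w\mapsto\operatorname{cl}_c(w)$ is a bijection from the set of $c$-sortable elements of $W$ to the set of $c$-clusters. Furthermore, $\operatorname{cl}_c$ restricts to a bijection between $c$-sortable elements with full support and positive $c$-clusters.
   Context: $W$ is a finite Coxeter group with simple generators $S$ ($|S|=n$) and reflections $T$; $l$ is length with respect to $S$. A Coxeter element $c$ is an element having a reduced word which is a permutation of $S$; $s\in S$ is initial in $c$ if it is the first letter of some reduced word for $c$. Sortability: fix a reduced word $a_1\cdots a_n$ for $c$ and form $c^\infty=a_1\cdots a_n|a_1\cdots a_n|\cdots$. The $c$-sorting word of $w$ is the lexicographically first (as a sequence of positions in $c^\infty$) subword of $c^\infty$ which is a reduced word for $w$; the letters between consecutive dividers give a sequence of subsets of $S$, and $w$ is $c$-sortable if this sequence is weakly decreasing under inclusion. The support of $w$ is the set of letters in a reduced word of $w$; full support means support $S$. Last reflections: if $a_1\cdots a_k$ is the $c$-sorting word of a $c$-sortable $w$ and $s\in S$ occurs in it, with rightmost occurrence $a_j$, the last reflection for $s$ is $a_1\cdots a_{j-1}a_ja_{j-1}\cdots a_1$; if $s$ does not occur, the last reflection for $s$ is the formal symbol $-s$. $\operatorname{cl}_c(w)$ is the set of the $n$ last reflections. Clusters: let $-S=\{-s:s\in S\}$ be formal negatives and $T_{\ge -1}=T\cup(-S)$; for $J\subseteq S$ let $W_J$ be the subgroup generated by $J$, $T_J=T\cap W_J$, $(T_J)_{\ge-1}=T_J\cup(-J)$, and write $\langle s\rangle=S\setminus\{s\}$.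 For $s\in S$ define the involution $\sigma_s$ of $T_{\ge -1}$ by $\sigma_s(\pm s)=\mp s$, $\sigma_s(t)=t$ for $t\in -S$, $t\ne -s$, and $\sigma_s(t)=sts$ for $t\in T\setminus\{s\}$. There is a unique family of symmetric binary relations $\parallel_c$ on $T_{\ge-1}$, indexed by Coxeter elements $c$, such that (i) for all $s\in S$, $t\in T_{\ge-1}$ and all $c$: $-s\parallel_c t$ iff $t\in(T_{\langle s\rangle})_{\ge-1}$; (ii) for all $t_1,t_2\in T_{\ge-1}$ and every initial letter $s$ of $c$: $t_1\parallel_c t_2$ iff $\sigma_s(t_1)\parallel_{scs}\sigma_s(t_2)$. This is $c$-compatibility. A $c$-cluster is a maximal subset of $T_{\ge -1}$ whose elements are pairwise $c$-compatible; it is positive if it contains no element of $-S$. *)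

(* Defs.v *)
From HB Require Import structures.
From mathcomp Require Import all_boot all_order all_fingroup.
From mathcomp Require Import boolp classical_sets functions.

Set Implicit Arguments.
Unset Strict Implicit.
Unset Printing Implicit Defensive.

Local Open Scope group_scope.

Section CoxeterSystem.
Variable gT : finGroupType.
Variable S : {set gT}.

(* The congruence on words in S generated by the relations (s t)^m(s,t) = 1,
   with m(s,t) the order of s t; the case s = t gives s s = 1, so no formal
   inverses are needed. *)
Inductive coxeter_congr : seq gT -> seq gT -> Prop :=
| CoxeterRefl u : coxeter_congr u u
| CoxeterSym u v : coxeter_congr u v -> coxeter_congr v u
| CoxeterTrans u v w :
    coxeter_congr u v -> coxeter_congr v w -> coxeter_congr u w
| CoxeterRel u v s t : s \in S -> t \in S ->
    coxeter_congr (u ++ flatten (nseq #[s * t] [:: s; t]) ++ v) (u ++ v).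

(* The group W is the whole type gT, and <S | (s t)^m(s,t) = 1> is a
   presentation of it. *)
Definition coxeter_system : Prop :=
  [/\ <<S>> = [set: gT]%SET,
      {in S, forall s, #[s] = 2} &
      forall u : seq gT, {subset u <= S} -> \prod_(x <- u) x = 1 ->
        coxeter_congr u [::]].

Definition word_of (w : gT) (u : seq gT) : Prop :=
  {subset u <= S} /\ \prod_(x <- u) x = w.

Definition reduced_word (w : gT) (u : seq gT) : Prop :=
  word_of w u /\ forall v, word_of w v -> size u <= size v.

Definition coxeter_element (c : gT) : Prop :=
  exists u, reduced_word c u /\ perm_eq u (enum S).

Definition initial (s c : gT) : Prop := exists u, reduced_word c (s :: u).

Definition full_support (w : gT) : Prop :=
  exists u, reduced_word w u /\ u =i S.

Definition reflections : {set gT} := class_support S [set: gT]%SET.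

(* Below, a = a_1 ... a_n is the chosen reduced word of c, and a subword of
   c^oo = a|a|a|... is given by its increasing sequence p of positions,
   counted from 0. *)
Definition cinfty (a : seq gT) (i : nat) : gT := nth 1 a (i %% size a).

Definition subword (a : seq gT) (p : seq nat) : seq gT := map (cinfty a) p.

Definition reduced_positions (a : seq gT) (w : gT) (p : seq nat) : Prop :=
  sorted ltn p /\ reduced_word w (subword a p).

Definition sorting_positions (a : seq gT) (w : gT) (p : seq nat) : Prop :=
  reduced_positions a w p /\
  forall q, reduced_positions a w q -> (p <= q :> seqlexi nat)%O.

(* The letters of the subword p between the k-th and (k+1)-st dividers. *)
Definition block (a : seq gT) (p : seq nat) (k : nat) : {set gT} :=
  [set x in subword a [seq i <- p | i %/ size a == k]]%SET.

Definition sortable (a : seq gT) (w : gT) : Prop :=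
  exists p, sorting_positions a w p /\
    forall k, block a p k.+1 \subset block a p k.

Definition sorting_word (a : seq gT) (w : gT) : seq gT :=
  subword a (xget [::] (sorting_positions a w)).

(* Elements of T_{>= -1} live in gT + gT: inl t is the reflection t, and inr s
   is the formal negative -s. *)
Definition last_reflection (u : seq gT) (s : gT) : gT + gT :=
  if s \in u then
    let v := take (size u - (index s (rev u)).+1) u in
    inl (\prod_(x <- v ++ s :: rev v) x)
  else inr s.

Definition cl (a : seq gT) (w : gT) : {set gT + gT} :=
  [set last_reflection (sorting_word a w) s | s in S]%SET.

(* (T_J)_{>= -1}; as S generates, J = S gives T_{>= -1}. *)
Definition Tge (J : {set gT}) : {set gT + gT} :=
  (@inl gT gT @: (reflections :&: <<J>>)) :|: (@inr gT gT @: J).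

Definition sigma (s : gT) (x : gT + gT) : gT + gT :=
  match x with
  | inl t => if t == s then inr s else inl (s * t * s)
  | inr r => if r == s then inl s else inr r
  end.

(* The characterization of the family of c-compatibility relations. Only the
   values at Coxeter elements and on T_{>= -1} are constrained, and only these
   are used. *)
Definition compatibility (compat : gT -> rel (gT + gT)) : Prop :=
  [/\ forall c, coxeter_element c -> {in Tge S &, symmetric (compat c)},
      forall c, coxeter_element c -> {in S & Tge S, forall s t,
        compat c (inr s) t = (t \in Tge (S :\ s))} &
      forall c s, coxeter_element c -> initial s c ->
        {in Tge S &, forall t1 t2,
        compat c t1 t2 = compat (s * c * s) (sigma s t1) (sigma s t2)}].

(* Only distinct elements are compared: -s is not compatible with itself. *)
Definition pairwise_compatible (r : rel (gT + gT)) (C : {set gT + gT}) : bool :=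
  (C \subset Tge S) &&
  [forall x in C, forall y in C, (x != y) ==> r x y].

Definition cluster (r : rel (gT + gT)) (C : {set gT + gT}) : Prop :=
  maxset (pairwise_compatible r) C.

Definition positive (C : {set gT + gT}) : Prop :=
  {in S, forall s, inr s \notin C}.

End CoxeterSystem.

(* Main.v *)
(* Rotation: if s is the first letter of the Coxeter word s a, then either s is
   a left descent of the c-sortable element w, and s w is sortable for a s with
   cl(w) = sigma_s cl(s w), or w lies in W_<s>, is sortable for a, and cl(w) is
   cl_a(w) together with -s.  So the theorem follows by induction on rank and on
   the number of rotations, given two facts that the axioms of compatibility do
   not show directly.

   (1) Compatibility restricts to parabolic subgroups.  In the geometric
   representation let E_a be the Euler form of the word a; rotating a by s and
   applying s to both arguments preserves it.  Two positive roots are compatible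
   iff E_a is nonnegative on them in both orders, and this condition visibly
   restricts to subwords of a.  A root meets a negative simple root after
   finitely many rotations, for otherwise the sum of its orbit under c would be
   a nonzero vector fixed by the whole group.

   (2) If s is the last letter of a and s is an inversion of the sortable
   element w, then s is a last reflection of w.  Along the inversion sequence of
   w the form omega_a(x, y) = E_a(x, y) - E_a(y, x) is nonnegative, and zero only
   on commuting reflections, whereas omega_a(alpha_s, -) is nonpositive on
   positive roots; so every inversion after s commutes with s. *)
Require Import Defs.
From mathcomp Require Import all_boot all_order all_fingroup all_algebra.
From mathcomp Require Import boolp classical_sets functions reals Rstruct trigo.
From mathcomp Require Import ring lra zify.

Set Implicit Arguments.
Unset Strict Implicit.
Unset Printing Implicit Defensive.
Import Order.TTheory GRing.Theory Num.Theory.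
Local Open Scope group_scope.
Local Open Scope ring_scope.

(** * The geometric representation, first for words *)

Section GeometricRepresentation.
Variables (R : realType) (gT : finGroupType) (S : {set gT}).

Local Notation wprod u := (\prod_(x <- u) x)%g.

(** Twice the usual Tits form, so that simple roots have norm 2 and [srefl] carries no factor 2.
    Vectors are functions on all of [gT]; this is harmless, because a word in [S] changes only
    coordinates in [S] and the relations are checked on arbitrary vectors. *)
Definition bform (r s : gT) : R := - (2 * cos (pi / #[(r * s)%g]%:R)).
Definition pairing (x : gT -> R) (s : gT) : R := \sum_r x r * bform r s.
Definition srefl (s : gT) (x : gT -> R) : gT -> R :=
  fun r => x r - (r == s)%:R * pairing x s.
Definition wact (u : seq gT) (x : gT -> R) : gT -> R := foldr srefl x u.
Definition simple (s : gT) : gT -> R := fun r => (r == s)%:R.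

Lemma bformC r s : bform r s = bform s r.
Proof.
rewrite /bform; suff -> : #[(r * s)%g] = #[(s * r)%g] by [].
by rewrite -(orderJ (r * s)%g r) conjgE mulgA mulKg.
Qed.

Lemma pairing_lin k x y s :
  pairing (fun r => k * x r + y r) s = k * pairing x s + pairing y s.
Proof.
rewrite /pairing big_distrr -big_split; apply: eq_bigr => r _ /=; ring.
Qed.

Lemma srefl_lin k x y s :
  srefl s (fun r => k * x r + y r) = fun r => k * srefl s x r + srefl s y r.
Proof. by apply/funext => r; rewrite /srefl pairing_lin; ring. Qed.

Lemma wact_lin k x y u :
  wact u (fun r => k * x r + y r) = fun r => k * wact u x r + wact u y r.
Proof. by elim: u => //= s u ->; rewrite srefl_lin. Qed.

Lemma wact0 u : wact u (fun=> 0) = fun=> 0.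
Proof.
elim: u => //= s u ->; apply/funext => r; rewrite /srefl.
by rewrite /pairing big1 => [|q _]; rewrite ?mul0r ?mulr0 ?subr0.
Qed.

Lemma wactZ k x u : wact u (fun r => k * x r) = fun r => k * wact u x r.
Proof.
have -> : (fun r => k * x r) = (fun r => k * x r + 0).
  by apply/funext => r; rewrite addr0.
by rewrite (wact_lin k x (fun=> 0)) wact0; apply/funext => r; rewrite addr0.
Qed.

Lemma wact_cat u v x : wact (u ++ v) x = wact u (wact v x).
Proof. by rewrite /wact foldr_cat. Qed.

Lemma wact_rcons u s x : wact (rcons u s) x = wact u (srefl s x).
Proof. by rewrite -cats1 wact_cat. Qed.

Lemma srefl_neq s r x : r != s -> srefl s x r = x r.
Proof. by rewrite /srefl => /negPf ->; rewrite mul0r subr0. Qed.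

Lemma wact_notin u r x : r \notin u -> wact u x r = x r.
Proof.
elim: u => //= s u IH; rewrite inE negb_or => /andP[rs ru].
by rewrite srefl_neq // IH.
Qed.

Lemma pairing_simple r s : pairing (simple r) s = bform r s.
Proof.
rewrite /pairing (bigD1 r) //= big1 /simple ?eqxx ?mul1r ?addr0 // => q /negPf ->.
by rewrite mul0r.
Qed.

Hypothesis coxS : coxeter_system S.

Let S2 : {in S, forall s, #[s]%g = 2%N}. Proof. by case: coxS. Qed.

Lemma mulss s : s \in S -> (s * s = 1)%g.
Proof. by move=> /S2 s2; rewrite -expg2 -s2 expg_order. Qed.

Lemma invS s : s \in S -> (s^-1 = s)%g.
Proof. by move=> sS; apply/eqP; rewrite eq_invg_mul mulss. Qed.

Lemma bformss s : s \in S -> bform s s = 2.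
Proof. by move=> sS; rewrite /bform mulss // order1 divr1 cospi mulrN1 opprK. Qed.

Lemma order_gt1 s t : s \in S -> t \in S -> s != t -> (1 < #[(s * t)%g])%N.
Proof.
move=> sS tS; apply: contraNltn; rewrite leq_eqVlt ltnNge order_gt0 orbF order_eq1.
by rewrite -eq_invg_mul invS.
Qed.

Lemma bform_le0 s t : s \in S -> t \in S -> s != t -> bform s t <= 0.
Proof.
move=> sS tS st; rewrite oppr_le0 mulr_ge0 //; apply: cos_ge0_pihalf.
have m2 := order_gt1 sS tS st; have pi0 := pi_ge0 R.
apply/andP; split.
  by apply: (@le_trans _ _ 0); rewrite ?oppr_le0 divr_ge0.
by apply: ler_pM; rewrite ?invr_ge0 // lef_pV2 ?posrE ?ltr0n ?ler_nat // ltnW.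
Qed.

Lemma sreflK s x : s \in S -> srefl s (srefl s x) = x.
Proof.
move=> sS; apply/funext => r; rewrite {1}/srefl.
have -> : srefl s x = (fun r => - pairing x s * simple s r + x r).
  by apply/funext => q; rewrite /srefl /simple; ring.
by rewrite pairing_lin pairing_simple bformss // /simple; ring.
Qed.

Lemma wact_revK u x : {subset u <= S} -> wact (rev u) (wact u x) = x.
Proof.
elim: u => //= s u IH uS; rewrite rev_cons wact_rcons sreflK ?uS ?mem_head //.
by rewrite IH // => r ru; rewrite uS // inE ru orbT.
Qed.

(** * Dihedral subgroups acting on the plane of two simple roots *)

Section Dihedral.

(* The alternating word of length k ending in t. *)
Fixpoint alt (k : nat) (s t : gT) : seq gT :=
  if k is k'.+1 then (if odd k' then s else t) :: alt k' s t else [::].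

Lemma size_alt k s t : size (alt k s t) = k.
Proof. by elim: k => //= k ->. Qed.

Lemma alt_rcons k s t : alt k.+1 s t = rcons (alt k t s) t.
Proof. by elim: k => //= k <-; rewrite /=; case: (odd k). Qed.

Lemma alt_subset k s t : s \in S -> t \in S -> {subset alt k s t <= S}.
Proof.
move=> sS tS; elim: k => //= k IH r; rewrite inE => /predU1P[->|/IH //].
by case: ifP.
Qed.

Lemma alt_double k s t : alt k.*2 s t = flatten (nseq k [:: s; t]).
Proof. by elim: k => //= k ->; rewrite odd_double. Qed.

Lemma wprod_alt_double k s t : wprod (alt k.*2 s t) = ((s * t) ^+ k)%g.
Proof.
by elim: k => [|k IH]; rewrite /= ?big_nil // !big_cons IH odd_double mulgA expgS.
Qed.

(** The braid relation: a power of t s is the inverse of the same power of s t, so moving everything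
    to one side leaves (s t)^m = 1. *)
Lemma wprod_alt_braid s t : s \in S -> t \in S ->
  wprod (alt #[(s * t)%g] s t) = wprod (alt #[(s * t)%g] t s).
Proof.
move=> sS tS; set m := #[_]%g; rewrite -[m](odd_double_half m).
have mE : ((s * t) ^+ m = 1)%g by rewrite expg_order.
have tsE k : ((t * s) ^+ k = (s * t) ^- k)%g.
  by rewrite -expgVn invMg !invS.
case: (boolP (odd m)) => mo; rewrite ?add0n ?add1n /= ?odd_double /= ?big_cons.
  rewrite !wprod_alt_double tsE; apply/(mulgI s)/eqP.
  rewrite !mulgA mulss // mul1g eq_sym eq_invg_mul -expgS -expgD.
  by rewrite addnS addnn -[X in _ == X]mE -[in X in _ == X](odd_double_half m) mo.
rewrite !wprod_alt_double tsE; apply/eqP; rewrite eq_sym eq_invg_mul -expgD addnn.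
by rewrite -[X in _ == X]mE -[in X in _ == X](odd_double_half m) (negPf mo).
Qed.

Variables s t : gT.
Hypotheses (sS : s \in S) (tS : t \in S) (st : s != t).
Let theta : R := pi / #[(s * t)%g]%:R.
(** Chebyshev polynomials of the second kind at cos theta; they are the coordinates of the roots in
    the plane. *)
Let f (k : nat) : R := sin (k%:R * theta) / sin theta.

Definition planar (p q : R) (s t : gT) : gT -> R :=
  fun r => p * simple s r + q * simple t r.

Let m_gt1 := order_gt1 sS tS st.

Let mtheta : #[(s * t)%g]%:R * theta = pi.
Proof. by rewrite /theta mulrC divfK // pnatr_eq0 -lt0n ltnW. Qed.

Let sin_gt0 : 0 < sin theta.
Proof.
have p0 := pi_gt0 R; have m0 : 0 < #[(s * t)%g]%:R :> R by rewrite ltr0n ltnW.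
by apply: sin_gt0_pi; rewrite divr_gt0 //= ltr_pdivrMr // ltr_pMr // ltr1n.
Qed.

Let f_rec k : f k.+2 = 2 * cos theta * f k.+1 - f k.
Proof.
have sn0 : sin theta != 0 by rewrite gt_eqF.
have fE j : f j * sin theta = sin (j%:R * theta) by rewrite divfK.
apply: (mulIf sn0); rewrite mulrBl -[X in _ = X - _]mulrA !fE.
have SE (j : nat) : j.+1%:R * theta = j%:R * theta + theta.
  by rewrite -natr1 mulrDl mul1r.
rewrite !SE !(sinD, cosD).
set a := sin (k%:R * theta); set b := cos (k%:R * theta).
have := cos2Dsin2 theta; set c := cos theta; set d := sin theta => h.
transitivity (2 * c * (a * c + b * d) - a * (c ^+ 2 + d ^+ 2)); first by ring.
by rewrite h; ring.
Qed.

(** The image is written with [v] first, so that by [f_rec] each letter of an alternating word moves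
    the coordinate pair one step along [f]. *)
Lemma srefl_planar p q u v : u \in S -> v \in S -> bform u v = - (2 * cos theta) ->
  srefl v (planar p q u v) = planar (2 * cos theta * p - q) p v u.
Proof.
move=> uS vS uv; apply/funext => r; rewrite /srefl.
have -> : planar p q u v = (fun r => p * simple u r + (q * simple v r + 0)).
  by apply/funext => z; rewrite /planar addr0.
rewrite !pairing_lin !pairing_simple bformss // uv.
have -> : pairing (fun=> 0) v = 0.
  by rewrite /pairing big1 // => z _; rewrite mul0r.
by rewrite /planar /simple; ring.
Qed.

Lemma wact_alt_planar k j :
  wact (alt k s t) (planar (f j.+1) (f j) s t) =
    (if odd k then planar (f (j + k).+1) (f (j + k)) t s
     else planar (f (j + k).+1) (f (j + k)) s t) /\
  wact (alt k t s) (planar (f j.+1) (f j) t s) =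
    (if odd k then planar (f (j + k).+1) (f (j + k)) s t
     else planar (f (j + k).+1) (f (j + k)) t s).
Proof.
elim: k j => [|k IH] j; first by rewrite addn0.
rewrite !alt_rcons !wact_rcons !srefl_planar //; last by rewrite bformC.
by rewrite -f_rec; case: (IH j.+1) => -> ->; rewrite /= -addSnnS; case: odd.
Qed.

Let f0 : f 0 = 0. Proof. by rewrite /f mul0r sin0 mul0r. Qed.
Let f1 : f 1 = 1. Proof. by rewrite /f mul1r divff // gt_eqF. Qed.
Let f2m : f #[(s * t)%g].*2 = 0.
Proof. by rewrite /f -muln2 natrM mulrAC mtheta mulr_natr sin2pi mul0r. Qed.
Let f_period k : f (k + #[(s * t)%g].*2) = f k.
Proof.
rewrite /f natrD mulrDl -muln2 natrM mulrAC mtheta.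
by rewrite mulr_natr sinD2pi.
Qed.

(** The coordinates are f k and f (k+1), and both angles k theta and (k+1) theta lie in [0, pi] as
    long as k < m. *)
Lemma wact_alt_simple k : (k < #[(s * t)%g])%N ->
  exists p q, [/\ 0 <= p, 0 <= q & wact (alt k s t) (simple s) = planar p q s t].
Proof.
move=> km; have fge0 j : (j <= #[(s * t)%g])%N -> 0 <= f j.
  move=> jm; apply: divr_ge0; last exact: ltW.
  apply: sin_ge0_pi; rewrite mulr_ge0 //=; last first.
    by rewrite divr_ge0 ?pi_ge0.
  by rewrite -mtheta ler_wpM2r ?ler_nat // divr_ge0 ?pi_ge0.
have [+ _] := wact_alt_planar k 0; rewrite f0 f1 add0n.
have -> : planar 1 0 s t = simple s.
  by apply/funext => r; rewrite /planar; ring.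
move=> ->; case: odd; last by exists (f k.+1), (f k); rewrite !fge0 // ltnW.
exists (f k), (f k.+1); rewrite !fge0 // 1?ltnW //; split=> //.
by apply/funext => r; rewrite /planar; ring.
Qed.

(** Split x into a part in the plane of the two simple roots, fixed by the periodicity of [f], and a
    part orthogonal to both, fixed by each reflection. *)
Lemma wact_alt_period x : wact (alt #[(s * t)%g].*2 s t) x = x.
Proof.
set m := #[(s * t)%g]; set u := alt _ _ _.
have us : wact u (simple s) = simple s.
  have -> : simple s = planar (f 1) (f 0) s t.
    by apply/funext => r; rewrite /planar f0 f1; ring.
  by case: (wact_alt_planar m.*2 0) => -> _; rewrite odd_double -addSn !f_period.
have ut : wact u (simple t) = simple t.
  have m1 : (m.*2.-1).+1 = m.*2 by rewrite prednK // double_gt0 ltnW.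
  (* Since f (2m) = 0 and f (2m-1) = -1, the vector -alpha_t is itself a planar vector with
     consecutive values of [f] as coordinates, so periodicity applies to it as well. *)
  have fm1 : f m.*2.-1 = - 1.
    have := f_rec m.*2.-1; rewrite m1 -[m.*2.+1]add1n f_period f1 f2m; lra.
  have e : simple t = (fun r => -1 * planar (f m.*2.-1.+1) (f m.*2.-1) s t r).
    by apply/funext => r; rewrite /planar m1 f2m fm1; ring.
  rewrite [in LHS]e wactZ; case: (wact_alt_planar m.*2 m.*2.-1) => -> _.
  by rewrite odd_double -addSn !f_period -e.
pose c := cos theta; pose d := 2 * (1 - c ^+ 2).
have d0 : d != 0.
  by rewrite /d /c -sin2cos2; apply: mulf_neq0; rewrite ?pnatr_eq0 // expf_neq0 // gt_eqF.
have d1 : 1 - c ^+ 2 != 0 by move: d0; rewrite mulf_eq0 negb_or => /andP[].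
(* p and q solve the Gram system that makes y orthogonal to both simple roots; d is half its
   determinant. *)
pose p := (pairing x s + c * pairing x t) / d.
pose q := (pairing x t + c * pairing x s) / d.
pose y := fun r => (- p) * simple s r + (- q * simple t r + x r).
have bst : bform s t = - (2 * c) by [].
have yfix z : z \in [:: s; t] -> srefl z y = y.
  move=> zst; have zS : z \in S by move: zst; rewrite !inE => /orP[]/eqP->.
  suff y0 : pairing y z = 0 by apply/funext => r; rewrite /srefl y0 mulr0 subr0.
  rewrite !pairing_lin !pairing_simple.
  move: zst; rewrite !inE => /orP[]/eqP->.
    by rewrite bformss // bformC bst /p /q /d;
      field; rewrite d1.
  by rewrite bformss // bst /p /q /d;
      field; rewrite d1.
have uy : wact u y = y.
  rewrite /u; elim: m.*2 => //= k ->; case: (odd k); apply: yfix; rewrite !inE eqxx ?orbT //.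
have xE : x = fun r => p * simple s r + (q * simple t r + y r).
  by apply/funext => r; rewrite /y; ring.
rewrite [in LHS]xE (wact_lin p (simple s) (fun r => q * simple t r + y r)).
by rewrite (wact_lin q (simple t) y) us ut uy -xE.
Qed.

End Dihedral.

(** * Descent of the action from words to the group *)

Lemma wact_congr u v x : coxeter_congr S u v -> wact u x = wact v x.
Proof.
move=> uv; elim: uv x => // [{}u {}v w _ IH1 _ IH2 x|]; first by rewrite IH1.
move=> {}u {}v s t sS tS x; rewrite !wact_cat; congr wact.
rewrite -alt_double; have [<-|st] := eqVneq s t.
  by rewrite mulss // order1 /= sreflK.
exact: wact_alt_period.
Qed.

Lemma wprod_rev u : {subset u <= S} -> wprod (rev u) = (wprod u)^-1%g.
Proof.
elim: u => [|s u IH] uS; rewrite ?big_nil ?invg1 //.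
rewrite rev_cons -cats1 big_cat /= big_seq1 big_cons invMg.
by rewrite IH ?(invS (uS _ (mem_head _ _))) // => r ru; rewrite uS // inE ru orbT.
Qed.

(** The presentation enters here: [u] followed by the reverse of [v] has product 1, hence is
    congruent to the empty word and acts trivially. *)
Lemma wact_eq u v x : {subset u <= S} -> {subset v <= S} ->
  wprod u = wprod v -> wact u x = wact v x.
Proof.
move=> uS vS uv; have [_ _ pres] := coxS.
have /wact_congr cong : coxeter_congr S (u ++ rev v) [::].
  apply: pres => [r|]; first by rewrite mem_cat mem_rev => /orP[/uS|/vS].
  by rewrite big_cat /= wprod_rev // uv mulgV.
by rewrite -[RHS](cong (wact v x)) wact_cat wact_revK.
Qed.

Lemma gen_word (J : {set gT}) g : g \in <<J>>%g ->
  exists u, {subset u <= J} /\ wprod u = g.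
Proof.
case/gen_prodgP => n [c cJ ->]; exists (map c (index_enum 'I_n)); split.
  by move=> r /mapP[i _ ->].
by rewrite big_map.
Qed.

Lemma wprod_gen (J : {set gT}) u : {subset u <= J} -> wprod u \in <<J>>%g.
Proof. by move=> uJ; rewrite big_seq group_prod // => r /uJ; apply: mem_gen. Qed.

Lemma has_word g : exists u, word_of S g u.
Proof. by apply: gen_word; case: coxS => -> _ _; rewrite inE. Qed.

(** Some word for g is chosen; [actE] shows that the choice does not matter. *)
Definition act (g : gT) : (gT -> R) -> gT -> R :=
  wact (xget [::] (word_of S g)).

Lemma actE u x : {subset u <= S} -> act (wprod u) x = wact u x.
Proof.
move=> uS; have [vS vE] := xgetPex [::] (has_word (wprod u)).
exact: wact_eq.
Qed.

Lemma act_word g u x : word_of S g u -> act g x = wact u x.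
Proof. by case=> uS <-; rewrite actE. Qed.

Lemma act1 x : act 1%g x = x.
Proof. by rewrite (@act_word _ [::]) //; split; rewrite ?big_nil. Qed.

Lemma word_ofM g h u v : word_of S g u -> word_of S h v ->
  word_of S (g * h)%g (u ++ v).
Proof.
move=> [uS <-] [vS <-]; split; last by rewrite big_cat.
by move=> r; rewrite mem_cat => /orP[/uS|/vS].
Qed.

Lemma actM g h x : act (g * h)%g x = act g (act h x).
Proof.
have [[u gu] [v hv]] := (has_word g, has_word h).
by rewrite (act_word _ (word_ofM gu hv)) wact_cat -(act_word _ gu) -(act_word _ hv).
Qed.

Lemma word_of1 s : s \in S -> word_of S s [:: s].
Proof. by move=> sS; split; rewrite ?big_seq1 // => r; rewrite inE => /eqP->. Qed.

Lemma actS s x : s \in S -> act s x = srefl s x.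
Proof. by move=> sS; rewrite (act_word _ (word_of1 sS)). Qed.

Lemma act_lin k x y g :
  act g (fun r => k * x r + y r) = fun r => k * act g x r + act g y r.
Proof. exact: wact_lin. Qed.

Lemma actZ k x g : act g (fun r => k * x r) = fun r => k * act g x r.
Proof. exact: wactZ. Qed.

Lemma actK g x : act g^-1%g (act g x) = x.
Proof. by rewrite -actM mulVg act1. Qed.

Lemma actVK g x : act g (act g^-1%g x) = x.
Proof. by rewrite -actM mulgV act1. Qed.

Lemma act_notin (J : {set gT}) g r x : J \subset S -> g \in <<J>>%g ->
  r \notin J -> act g x r = x r.
Proof.
move=> /fintype.subsetP JS /gen_word[u [uJ <-]] rJ; rewrite actE => [|q /uJ /JS //].
by rewrite wact_notin //; apply: contra rJ; apply: uJ.
Qed.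

Lemma act_sum (I : finType) (P : pred I) (F : I -> gT -> R) g :
  act g (fun r => \sum_(i | P i) F i r) = fun r => \sum_(i | P i) act g (F i) r.
Proof.
elim: (index_enum I) => [|i l IH].
  rewrite (_ : (fun=> _) = (fun=> 0)); last by apply/funext => r; rewrite big_nil.
  by rewrite /act wact0; apply/funext => r; rewrite big_nil.
case Pi: (P i); last first.
  rewrite (_ : (fun r => _) = (fun r => \sum_(j <- l | P j) F j r)); last first.
    by apply/funext => r; rewrite big_cons Pi.
  by rewrite IH; apply/funext => r; rewrite big_cons Pi.
rewrite (_ : (fun r => _) = (fun r => 1 * F i r + \sum_(j <- l | P j) F j r)).
  by rewrite act_lin IH; apply/funext => r; rewrite big_cons Pi mul1r.
by apply/funext => r; rewrite big_cons Pi mul1r.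
Qed.

(** * Length and positivity of roots *)

Lemma has_length g : exists n, `[< exists u, word_of S g u /\ size u = n >].
Proof. by have [u gu] := has_word g; exists (size u); apply/asboolP; exists u. Qed.

Definition len (g : gT) : nat := ex_minn (has_length g).

Lemma len_word g : exists u, word_of S g u /\ size u = len g.
Proof. by rewrite /len; case: ex_minnP => n /asboolP. Qed.

Lemma len_le g u : word_of S g u -> (len g <= size u)%N.
Proof.
by rewrite /len; case: ex_minnP => n _ + gu; apply; apply/asboolP; exists u.
Qed.

Lemma reduced_wordP g u : reduced_word S g u <-> word_of S g u /\ size u = len g.
Proof.
split=> [[gu umin]|[gu ug]]; split=> //; last first.
  by move=> v /len_le; rewrite ug.
apply/eqP; rewrite eqn_leq len_le // andbT.
by have [v [gv <-]] := len_word g; apply: umin.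
Qed.

Lemma lenM g h : (len (g * h)%g <= len g + len h)%N.
Proof.
have [[u [gu <-]] [v [hv <-]]] := (len_word g, len_word h).
by rewrite -size_cat len_le //; apply: word_ofM.
Qed.

Lemma lenS s : s \in S -> (len s <= 1)%N.
Proof. by move=> sS; rewrite (@len_le s [:: s]) //; apply: word_of1. Qed.

Lemma lenMs g s : s \in S -> (len (g * s)%g <= (len g).+1)%N.
Proof. by move=> sS; rewrite (leq_trans (lenM _ _)) // -addn1 leq_add2l lenS. Qed.

Lemma lenMs_ge g s : s \in S -> (len g <= (len (g * s)%g).+1)%N.
Proof. by move=> sS; rewrite -{1}[g]mulg1 -(mulss sS) mulgA lenMs. Qed.

Lemma lenV g : len g^-1%g = len g.
Proof.
suff le h : (len h^-1%g <= len h)%N by apply/eqP; rewrite eqn_leq le -{1}[g]invgK le.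
have [u [[uS uh] <-]] := len_word h; rewrite -size_rev len_le //; split.
  by move=> r; rewrite mem_rev => /uS.
by rewrite wprod_rev // uh.
Qed.

Lemma len0 g : len g = 0%N -> g = 1%g.
Proof. by have [u [[_ <-] <-]] := len_word g => /size0nil->; rewrite big_nil. Qed.

Lemma len_descent g : (0 < len g)%N -> exists2 s, s \in S & (len (g * s)%g < len g)%N.
Proof.
have [u [[uS ug] <-]] := len_word g; case/lastP: u uS ug => // u s uS ug _.
have sS : s \in S by rewrite uS // mem_rcons mem_head.
exists s => //; rewrite size_rcons ltnS len_le //; split.
  by move=> r ru; rewrite uS // mem_rcons inE ru orbT.
by rewrite -ug -cats1 big_cat /= big_seq1 -mulgA mulss // mulg1.
Qed.

(* Peel off from g the longest alternating suffix in s and t; what remains has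
   smaller length and keeps both alpha_s and alpha_t positive. *)
Lemma act_simple_ge0 g s : s \in S -> (len g <= len (g * s)%g)%N ->
  forall r, 0 <= act g (simple s) r.
Proof.
have [n] := ubnP (len g); elim: n => // n IH in g s *; rewrite ltnS => gn sS gs.
have [/len0 ->|g0] := posnP (len g); first by move=> r; rewrite act1 ler0n.
have [t tS gt] := len_descent g0.
have st : s != t by apply: contraTneq gt => <-; rewrite -leqNgt.
pose v k := (g * (wprod (alt k s t))^-1)%g.
have vS k : (v k.+1 * (if odd k then s else t) = v k)%g.
  by rewrite /v /= big_cons invMg mulgA mulgKV.
have vE k : (v k * wprod (alt k s t))%g = g by rewrite mulgKV.
have len_alt k : (len (wprod (alt k s t)) <= k)%N.
  by rewrite -[X in (_ <= X)%N](size_alt k s t) len_le //; split=> //; apply: alt_subset.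
have vk k : (len g <= len (v k) + k)%N.
  by rewrite -{1}(vE k) (leq_trans (lenM _ _)) // leq_add2l.
(* [P k] says that the alternating word of length k splits off g on the right without loss of
   length; it is inherited by smaller k. *)
pose P k := (len (v k) + k == len g)%N.
have PS k : P k.+1 -> P k.
  move=> /eqP Pk; rewrite /P eqn_leq vk andbT -(vS k) -Pk addnS -addSn leq_add2r.
  by rewrite lenMs //; case: ifP.
have P1 : exists k, P k.
  exists 0%N; by rewrite /P /v /= big_nil invg1 mulg1 addn0.
have Pmax k : P k -> (k <= len g)%N by move=> /eqP <-; rewrite leq_addl.
have Pk_ge1 : P 1%N.
  rewrite /P eqn_leq vk andbT addn1 /v /= big_seq1 invS //.
have [k Pk kmax] := ex_maxnP P1 Pmax.
have k0 : (0 < k)%N by apply: kmax.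
(* If k reached the order m, the braid relation would rewrite the suffix to end in s instead of t,
   so s would shorten g. *)
have km : (k < #[(s * t)%g])%N.
  rewrite ltnNge; apply/negP => mk.
  have Pm : P #[(s * t)%g].
    move: Pk; rewrite -(subnK mk); elim: (k - _)%N => // j IHj.
    by rewrite addSn => /PS.
  have m1 : (#[(s * t)%g].-1.+1 = #[(s * t)%g])%N by rewrite prednK.
  have gE : g = (v #[(s * t)%g] * wprod (alt #[(s * t)%g].-1 s t) * s)%g.
    by rewrite -mulgA -{1}(vE #[(s * t)%g]) wprod_alt_braid // -[in alt _ t s]m1
      alt_rcons -cats1 big_cat /= big_seq1.
  have := gs; rewrite [in X in (_ <= len X)%N]gE -mulgA mulss // mulg1.
  rewrite leqNgt => /negP; apply.
  rewrite (leq_ltn_trans (lenM _ _)) // -(eqP Pm) ltn_add2l.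
  by rewrite (leq_ltn_trans (len_alt _)) // ltn_predL.
have vkn : (len (v k) < n)%N.
  by rewrite (leq_trans _ gn) // -(eqP Pk) -addn1 leq_add2l.
(* Neither s nor t shortens [v k] on the right: one of them leads to [v k.+1], which is not shorter
   by maximality of k, the other leads back to [v k.-1]. *)
have vge x : x \in [:: s; t] -> forall r, 0 <= act (v k) (simple x) r.
  move=> xst; have xS : x \in S by move: xst; rewrite !inE => /orP[]/eqP->.
  apply: IH => //.
  case: (eqVneq x (if odd k then s else t)) => [->|xk].
    rewrite leqNgt; apply/negP => lt; suff : P k.+1 by move/kmax; rewrite ltnn.
    rewrite /P eqn_leq vk andbT addnS -addSn -(eqP Pk) leq_add2r.
    suff -> : v k.+1 = (v k * (if odd k then s else t))%g by [].
    by rewrite -(vS k) -mulgA mulss ?mulg1 //; case: ifP.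
  have -> : x = if odd k.-1 then s else t.
    move: xst xk; rewrite -[in odd k](prednK k0) /= !inE; case: (odd _) => /=.
      by case/orP => /eqP -> //; rewrite eqxx.
    by case/orP => /eqP -> //; rewrite eqxx.
  have := vS k.-1; rewrite prednK // => ->.
  rewrite -(leq_add2r k) (eqP Pk) (leq_trans (vk k.-1)) // leq_add2l leq_pred //.
have [p [q [p0 q0 pq]]] := wact_alt_simple sS tS st km.
move=> r; rewrite -(vE k) actM actE; last exact: alt_subset.
rewrite pq /planar act_lin (actZ q); apply: addr_ge0; apply: mulr_ge0 => //.
  by apply: vge; rewrite inE eqxx.
by apply: vge; rewrite !inE eqxx orbT.
Qed.

Lemma srefl_simple s : s \in S -> srefl s (simple s) = fun r => -1 * simple s r.
Proof.
move=> sS; apply/funext => r; rewrite /srefl pairing_simple bformss //.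
by rewrite /simple; ring.
Qed.

Lemma act_simple_le0 g s : s \in S -> (len (g * s)%g <= len g)%N ->
  forall r, act g (simple s) r <= 0.
Proof.
move=> sS gs r; have := @act_simple_ge0 (g * s)%g s sS.
rewrite -mulgA mulss // mulg1 => /(_ gs r).
by rewrite actM (actS _ sS) srefl_simple // actZ mulN1r oppr_ge0.
Qed.

(** A nontrivial element has a right descent s and sends alpha_s to a nonpositive vector. *)
Lemma act_faithful g : (forall s, s \in S -> act g (simple s) = simple s) -> g = 1%g.
Proof.
move=> gfix; apply: len0; apply/eqP; rewrite -leqn0 leqNgt; apply/negP => g0.
have [s sS gs] := len_descent g0.
have := act_simple_le0 sS (ltnW gs) s.
by rewrite gfix // /simple eqxx lern0.
Qed.

Definition form (x y : gT -> R) : R := \sum_r y r * pairing x r.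

Lemma formC x y : form x y = form y x.
Proof.
rewrite /form /pairing; under eq_bigr do rewrite big_distrr /=.
rewrite exchange_big; apply: eq_bigr => q _ /=; rewrite big_distrr /=.
by apply: eq_bigr => r _; rewrite bformC; ring.
Qed.

Lemma form_linl k x y z :
  form (fun r => k * x r + y r) z = k * form x z + form y z.
Proof.
rewrite /form big_distrr -big_split; apply: eq_bigr => r _ /=.
by rewrite pairing_lin; ring.
Qed.

Lemma form_linr k x y z :
  form z (fun r => k * x r + y r) = k * form z x + form z y.
Proof. by rewrite !(formC z) form_linl. Qed.

Lemma formZl k x z : form (fun r => k * x r) z = k * form x z.
Proof.
rewrite -[RHS]addr0 -[X in _ = _ + X](_ : form (fun=> 0) z = 0); last first.
  rewrite /form big1 // => r _; rewrite /pairing big1 ?mulr0 // => q _.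
  by rewrite mul0r.
rewrite -form_linl; congr form; apply/funext => r; exact/esym/addr0.
Qed.

Lemma formZr k x z : form z (fun r => k * x r) = k * form z x.
Proof. by rewrite !(formC z) formZl. Qed.

Lemma form_simple x s : form x (simple s) = pairing x s.
Proof.
rewrite /form (bigD1 s) //= big1 /simple ?eqxx ?mul1r ?addr0 // => q /negPf ->.
by rewrite mul0r.
Qed.

Lemma srefl_form s x : srefl s x = fun r => - form x (simple s) * simple s r + x r.
Proof. by apply/funext => r; rewrite form_simple /srefl /simple; ring. Qed.

Lemma form_act g x y : form (act g x) (act g y) = form x y.
Proof.
have [u [uS <-]] := has_word g; rewrite !actE //.
elim: u uS => //= s u IH uS; have sS := uS _ (mem_head s u).
rewrite -[RHS]IH => [|r ru]; last by rewrite uS // inE ru orbT.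
rewrite !srefl_form !(form_linl, form_linr) (formC (simple s)).
by rewrite !form_simple pairing_simple bformss //; ring.
Qed.

(** * Reflections and positive roots *)

Definition is_root (t : gT) (b : gT -> R) : Prop :=
  (forall r, 0 <= b r) /\
  exists w s, [/\ s \in S, t = (w * s * w^-1)%g & b = act w (simple s)].

Lemma reflectionP t :
  reflect (exists w s, s \in S /\ t = (w * s * w^-1)%g) (t \in reflections S).
Proof.
apply: (iffP imset2P) => [[s w sS _ ->]|[w [s [sS ->]]]].
  by exists w^-1%g, s; split; rewrite // invgK conjgE mulgA.
by exists s w^-1%g; rewrite ?inE // conjgE invgK mulgA.
Qed.

Lemma simple_reflection s : s \in S -> s \in reflections S.
Proof. by move=> sS; apply/reflectionP; exists 1%g, s; rewrite mul1g invg1 mulg1. Qed.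

Lemma reflection_conj g t : t \in reflections S -> (t ^ g)%g \in reflections S.
Proof.
case/reflectionP => w [s [sS ->]]; apply/reflectionP; exists (g^-1 * w)%g, s.
by split=> //; rewrite conjgE invMg invgK !mulgA.
Qed.

Lemma reflection_conjS s t : s \in S -> t \in reflections S ->
  (s * t * s)%g \in reflections S.
Proof. by move=> sS /(reflection_conj s); rewrite conjgE invS // mulgA. Qed.

Lemma has_root t : t \in reflections S -> exists b, is_root t b.
Proof.
case/reflectionP => w [s [sS ->]].
have [ws|ws] := leqP (len w) (len (w * s)%g).
  by exists (act w (simple s)); split; [apply: act_simple_ge0|exists w, s].
have E : act (w * s)%g (simple s) = fun r => -1 * act w (simple s) r.
  by rewrite actM (actS _ sS) srefl_simple // actZ.
exists (act (w * s)%g (simple s)); split.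
  by move=> r; rewrite E mulN1r oppr_ge0 act_simple_le0 // ltnW.
exists (w * s)%g, s; split=> //.
by rewrite invMg (invS sS) -!mulgA [(s * (s * _))%g]mulgA mulss // mul1g.
Qed.

Definition root (t : gT) : gT -> R := xget (fun=> 0) (is_root t).

Lemma rootP t : t \in reflections S -> is_root t (root t).
Proof. by move=> /has_root; apply: xgetPex. Qed.

Lemma root_ge0 t r : t \in reflections S -> 0 <= root t r.
Proof. by case/rootP => + _; apply. Qed.

Lemma form_root t b : is_root t b -> form b b = 2.
Proof.
case=> _ [w [s [sS _ ->]]].
by rewrite form_act form_simple pairing_simple bformss.
Qed.

Lemma act_reflection t b x : is_root t b ->
  act t x = fun r => - form x b * b r + x r.
Proof.
case=> _ [w [s [sS -> ->]]]; rewrite !actM (actS _ sS) srefl_form act_lin actVK.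
by rewrite -{1}(form_act w) actVK.
Qed.

(** Writing the reflection of b by both formulas shows that b and b' are proportional. Both have
    norm 2, so the factor is 1 or -1, and positivity excludes -1. *)
Lemma is_root_uniq t b b' : is_root t b -> is_root t b' -> b = b'.
Proof.
move=> tb tb'; have [b0 _] := tb; have [b'0 _] := tb'.
have := act_reflection b tb; rewrite (act_reflection b tb') (form_root tb) => E.
set k := form b b' in E.
have kb r : k * b' r = 2 * b r.
  by have /(congr1 (fun f => f r)) := E => /=; lra.
have k2 : k ^+ 2 = 4.
  have : form (fun r => k * b' r) (fun r => k * b' r) = 2 * k ^+ 2.
    by rewrite formZl formZr (form_root tb'); ring.
  by rewrite (funext kb) formZl formZr (form_root tb); lra.
have /orP[/eqP k_2|/eqP k_2] : (k == 2) || (k == -2).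
  by rewrite -eqf_sqr k2; apply/eqP; ring.
  by apply/funext => r; have := kb r; rewrite k_2; lra.
have bz : b = fun=> 0.
  by apply/funext => r; have := kb r; have := b0 r; have := b'0 r; rewrite k_2; lra.
have := form_root tb; rewrite bz /form big1 => [/eqP|r _]; last by rewrite mul0r.
by rewrite eq_sym pnatr_eq0.
Qed.

Lemma rootE t b : is_root t b -> root t = b.
Proof. by move=> tb; apply: (xget_unique _ tb) => b' tb'; apply: is_root_uniq tb' tb. Qed.

Lemma root_simple s : s \in S -> root s = simple s.
Proof.
move=> sS; apply: rootE; split=> [r|]; first exact: ler0n.
by exists 1%g, s; rewrite mul1g invg1 mulg1 act1.
Qed.

(** The root determines the action of its reflection, and the action is faithful. *)
Lemma root_inj : {in reflections S &, injective root}.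
Proof.
move=> t t' /rootP tb /rootP tb' E; apply/eqP; rewrite eq_mulVg1; apply/eqP.
apply: act_faithful => s _; rewrite actM.
by rewrite (act_reflection _ tb') -E -(act_reflection _ tb) actK.
Qed.

(** s permutes the positive roots other than alpha_s: such a root has a positive coordinate at some
    r different from s, which [srefl s] leaves alone, and a vector w alpha_p is either nonnegative
    or nonpositive. *)
Lemma root_conj s t : s \in S -> t \in reflections S -> t != s ->
  root (s * t * s)%g = srefl s (root t).
Proof.
move=> sS tT ts; apply: rootE; have tb := rootP tT; have [b0 [w [p [pS tE bE]]]] := tb.
have sbE : srefl s (root t) = act (s * w)%g (simple p) by rewrite actM (actS _ sS) -bE.
have bp : exists2 r, r != s & 0 < root t r.
  apply: contrapT => nb.
  have b00 r : r != s -> root t r = 0.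
    move=> rs; apply/eqP; rewrite eq_le b0 andbT leNgt; apply/negP => br.
    by apply: nb; exists r.
  have bs : root t = fun r => root t s * simple s r.
    by apply/funext => r; rewrite /simple; have [->|/b00->] := eqVneq r s; rewrite ?mulr1 ?mulr0.
  have := form_root tb; rewrite {1 2}bs formZl formZr form_simple.
  rewrite pairing_simple bformss // => b2.
  have bs1 : root t s = 1.
    apply/eqP; rewrite -(@eqrXn2 _ 2) // expr1n; apply/eqP; rewrite expr2; lra.
  move/negP: ts; apply; apply/eqP; apply: (root_inj tT (simple_reflection sS)).
  by rewrite (root_simple sS) bs bs1; apply/funext => r; rewrite mul1r.
split; last first.
  exists (s * w)%g, p; split=> //.
  by rewrite tE invMg (invS sS) !mulgA.
have [r rs br] := bp; rewrite sbE.
have [sw|sw] := leqP (len (s * w)%g) (len (s * w * p)%g); first exact: act_simple_ge0.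
have := act_simple_le0 pS (ltnW sw) r; rewrite -sbE srefl_neq // => br'.
by have := lt_le_trans br br'; rewrite ltxx.
Qed.

(** From left to right, t negates its root but cannot change coordinates outside J. Conversely, a
    root supported on J has positive norm, so it pairs positively with some alpha_s with s in J;
    conjugating by s lowers the height and keeps the support in J. *)
Lemma root_supp (J : {set gT}) t : J \subset S -> t \in reflections S ->
  (t \in <<J>>%g) <-> (forall r, r \notin J -> root t r = 0).
Proof.
move=> JS tT; split=> [tJ r rJ|].
  have := act_notin (root t) JS tJ rJ.
  rewrite (act_reflection _ (rootP tT)) (form_root (rootP tT)); lra.
pose h t := \sum_r root t r.
(* Heights are real numbers, so the induction is on the number of reflections of smaller height. *)
pose lower t := [set t' in reflections S | h t' < h t]%SET.
have [n] := ubnP #|lower t|; elim: n t tT => // n IH t tT; rewrite ltnS => tn bJ.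
have [s [sJ sp]] : exists s, s \in J /\ 0 < pairing (root t) s.
  apply: contrapT => nb; have := form_root (rootP tT).
  suff : form (root t) (root t) <= 0 by lra.
  apply: sumr_le0 => r _; have [rJ|/bJ->] := boolP (r \in J); last by rewrite mul0r.
  apply: mulr_ge0_le0; first exact: root_ge0.
  by rewrite leNgt; apply/negP => br; apply: nb; exists r.
have sS := fintype.subsetP JS s sJ.
have [-> |ts] := eqVneq t s; first exact: mem_gen.
have sE := root_conj sS tT ts; have sT := reflection_conjS sS tT.
have hlt : h (s * t * s)%g < h t.
  rewrite /h sE /srefl sumrB -big_distrl /=.
  have -> : \sum_(r : gT) (r == s)%:R = 1 :> R.
    by rewrite (bigD1 s) //= eqxx big1 ?addr0 // => r /negPf->.
  by rewrite mul1r; lra.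
suff stJ : (s * t * s)%g \in <<J>>%g.
  have -> : t = (s * (s * t * s) * s)%g.
    by rewrite !mulgA mulss // mul1g -mulgA mulss // mulg1.
  by have sG := mem_gen sJ; exact: groupM (groupM sG stJ) sG.
apply: IH => // [|r rJ]; last first.
  by rewrite sE srefl_neq ?bJ //; apply: contraNneq rJ => ->.
apply: leq_trans tn; apply: proper_card; apply/properP; split.
  apply/fintype.subsetP => t'; rewrite !inE => /andP[-> /=] h'.
  exact: lt_trans hlt.
by exists (s * t * s)%g; rewrite !inE sT ?hlt // ltxx.
Qed.

(** Strong exchange: apply the letters of [u] to the root in turn. By [root_conj] it stays positive
    until it meets the letter whose simple root it has become. *)
Lemma inversion_of_act_le0 u t : {subset u <= S} -> t \in reflections S ->
  (forall r, act (wprod u)^-1%g (root t) r <= 0) ->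
  exists u1 s u2, u = u1 ++ s :: u2 /\ t = (wprod u1 * s * (wprod u1)^-1)%g.
Proof.
elim: u t => [|s u IH] t uS tT.
  rewrite big_nil invg1 act1 => neg; exfalso.
  have := form_root (rootP tT); rewrite /form big1 => [/eqP|r _].
    by rewrite eq_sym pnatr_eq0.
  suff -> : root t r = 0 by rewrite mul0r.
  by apply/eqP; rewrite eq_le neg root_ge0.
have sS := uS _ (mem_head s u); have uS' : {subset u <= S}.
  by move=> r ru; rewrite uS // inE ru orbT.
have [-> _|ts] := eqVneq t s.
  by exists [::], s, u; rewrite big_nil mul1g invg1 mulg1.
rewrite big_cons invMg (invS sS) actM (actS _ sS) -root_conj // => neg.
have [u1 [p [u2 [-> E]]]] := IH _ uS' (reflection_conjS sS tT) neg.
exists (s :: u1), p, u2; split=> //; rewrite big_cons invMg (invS sS).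
rewrite !mulgA -(mulgA s) -(mulgA s) -E !mulgA.
by rewrite mulss // mul1g -mulgA mulss // mulg1.
Qed.

(** The last letter s of a reduced word is a right descent, so the s-coordinate of g alpha_s is
    nonpositive; but an element of W_J leaves coordinates outside J unchanged, and that coordinate
    would be 1. *)
Lemma reduced_support (J : {set gT}) g u : J \subset S -> g \in <<J>>%g ->
  reduced_word S g u -> {subset u <= J}.
Proof.
move=> JS; elim/last_ind: u g => // u s IH g gJ /reduced_wordP[[uS ug] su].
have sS : s \in S by rewrite uS // mem_rcons mem_head.
have gE : wprod u = (g * s)%g.
  by rewrite -ug -cats1 big_cat /= big_seq1 -mulgA mulss // mulg1.
have uS' : {subset u <= S} by move=> r ru; rewrite uS // mem_rcons inE ru orbT.
have gu : (len (g * s)%g <= size u)%N by apply: len_le; split.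
have gs : (len (g * s)%g < len g)%N by rewrite -su size_rcons ltnS.
have sJ : s \in J.
  apply/negP => sJ; have := act_simple_le0 sS (ltnW gs) s.
  by rewrite (act_notin _ JS gJ) ?(negPf sJ) ?lern0 ?/simple ?eqxx //; apply/negP.
move=> r; rewrite mem_rcons inE => /predU1P[->//|].
apply: (IH (g * s)%g); first by rewrite groupM // mem_gen.
apply/reduced_wordP; split=> //; apply/eqP; rewrite eqn_leq gu andbT.
by rewrite -ltnS -(size_rcons u s) su lenMs_ge.
Qed.

(** * The Euler form of a Coxeter word and the compatibility it defines *)

(* The bilinear form that is 1 on (alpha_s, alpha_s), and that is bform or 0 on
   (alpha_r, alpha_s) according to whether s precedes or follows r in the word. *)
Fixpoint euler (a : seq gT) (x y : gT -> R) : R :=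
  if a is s :: a' then
    euler a' x y + x s * y s + y s * \sum_(r <- a') x r * bform r s
  else 0.

Lemma euler_rcons a s x y : euler (rcons a s) x y =
  euler a x y + x s * y s + x s * \sum_(r <- a) y r * bform r s.
Proof.
elim: a => [|q a IH] /=; first by rewrite !big_nil; ring.
by rewrite IH -cats1 big_cat /= big_seq1 big_cons (bformC q s); ring.
Qed.

Lemma euler_ext a x y x' y' : {in a, x =1 x'} -> {in a, y =1 y'} ->
  euler a x y = euler a x' y'.
Proof.
elim: a => //= s a IH xx yy.
have xa : {in a, x =1 x'} by move=> r ra; rewrite xx // inE ra orbT.
have ya : {in a, y =1 y'} by move=> r ra; rewrite yy // inE ra orbT.
rewrite (IH xa ya) xx ?mem_head // yy ?mem_head //; congr (_ + _); congr (_ * _).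
by rewrite big_seq [RHS]big_seq; apply: eq_bigr => r /xa->.
Qed.

Lemma euler_0l a x y : {in a, forall r, x r = 0} -> euler a x y = 0.
Proof.
elim: a => //= s a IH x0; rewrite x0 ?mem_head // mul0r IH => [|r ra]; last first.
  by rewrite x0 // inE ra orbT.
by rewrite big_seq big1 ?mulr0 ?addr0 // => r ra; rewrite x0 ?mul0r // inE ra orbT.
Qed.

Lemma euler_0r a x y : {in a, forall r, y r = 0} -> euler a x y = 0.
Proof.
elim: a => //= s a IH y0; rewrite y0 ?mem_head // mulr0 mul0r IH ?addr0 // => r ra.
by rewrite y0 // inE ra orbT.
Qed.

Lemma pairing_supp a s x : s \in S -> uniq (s :: a) ->
  (forall r, r \notin s :: a -> x r = 0) ->
  pairing x s = 2 * x s + \sum_(r <- a) x r * bform r s.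
Proof.
move=> sS saU x0; rewrite /pairing (bigID [pred r | r \in s :: a]) /=.
rewrite -big_uniq // big_cons bformss // [X in _ + X]big1 => [|r /x0->].
  by rewrite addr0 mulrC.
by rewrite mul0r.
Qed.

Section EulerRotation.
Variables (s : gT) (a : seq gT).
Hypotheses (sS : s \in S) (saU : uniq (s :: a)).

Let sa r : r \in a -> r != s.
Proof. by move=> ra; apply: contraTneq saU => <-; rewrite /= ra. Qed.

Lemma euler_simple_first y : euler (s :: a) (simple s) y = y s.
Proof.
rewrite /= euler_0l => [|r /sa/negPf rs]; last by rewrite /simple rs.
rewrite big_seq big1 /simple => [|r /sa/negPf ->]; last by rewrite mul0r.
by rewrite eqxx /=; ring.
Qed.

Lemma euler_first_simple x : (forall r, r \notin s :: a -> x r = 0) ->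
  euler (s :: a) x (simple s) = - srefl s x s.
Proof.
move=> x0; rewrite /= euler_0r => [|r /sa/negPf rs]; last by rewrite /simple rs.
by rewrite /srefl (pairing_supp sS saU x0) /simple eqxx /=; ring.
Qed.

Lemma euler_last_simple x : euler (rcons a s) x (simple s) = x s.
Proof.
rewrite euler_rcons euler_0r => [|r /sa/negPf rs]; last by rewrite /simple rs.
rewrite big_seq big1 /simple => [|r /sa/negPf ->]; last by rewrite mul0r.
by rewrite eqxx /=; ring.
Qed.

Lemma euler_simple_last y :
  euler (rcons a s) (simple s) y = y s + \sum_(r <- a) y r * bform r s.
Proof.
rewrite euler_rcons euler_0l => [|r /sa/negPf rs]; last by rewrite /simple rs.
by rewrite /simple eqxx /=; ring.
Qed.

Lemma sum_srefl x : \sum_(r <- a) srefl s x r * bform r s = \sum_(r <- a) x r * bform r s.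
Proof. by rewrite !big_seq; apply: eq_bigr => r /sa rs; rewrite srefl_neq. Qed.

(** With X and Y the sums over [a] of the coordinates of x and y against alpha_s, both sides add (x
    s + X) * y s to the Euler form of [a]. *)
Lemma euler_rot x y : (forall r, r \notin s :: a -> x r = 0) ->
  (forall r, r \notin s :: a -> y r = 0) ->
  euler (rcons a s) (srefl s x) (srefl s y) = euler (s :: a) x y.
Proof.
move=> x0 y0; rewrite euler_rcons /= sum_srefl.
rewrite (euler_ext (x' := x) (y' := y)); last 2 first.
- by move=> r /sa rs; rewrite srefl_neq.
- by move=> r /sa rs; rewrite srefl_neq.
by rewrite /srefl !(pairing_supp sS saU) // eqxx /=; ring.
Qed.

Lemma euler_simple_last_srefl y : (forall r, r \notin s :: a -> y r = 0) ->
  euler (rcons a s) (simple s) (srefl s y) = - y s.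
Proof.
move=> y0; rewrite euler_simple_last sum_srefl /srefl (pairing_supp sS saU) //.
by rewrite eqxx /=; ring.
Qed.

End EulerRotation.

(** The guard [x != y] matches the axioms: by (i) a negative simple root is not compatible with
    itself, and (ii) carries this to every element that rotates to one. *)
Definition rcompat (a : seq gT) (x y : gT + gT) : bool :=
  (x != y) &&
  match x, y with
  | inr _, inr _ => true
  | inr s, inl t | inl t, inr s => root t s == 0
  | inl t, inl t' =>
      (0 <= euler a (root t) (root t')) && (0 <= euler a (root t') (root t))
  end.

Lemma rcompatC a : symmetric (rcompat a).
Proof. by move=> [t|s] [t'|s']; rewrite /rcompat eq_sym // [X in _ && X]andbC. Qed.

Lemma in_Tge_inl (J : {set gT}) t :
  (inl t \in Tge S J) = (t \in reflections S) && (t \in <<J>>%g).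
Proof.
rewrite !inE; apply/orP/andP => [[/imsetP[q]|/imsetP[//]]|[tT tJ]].
  by rewrite !inE => /andP[? ?] [->].
by left; apply: imset_f; rewrite inE tT.
Qed.

Lemma in_Tge_inr (J : {set gT}) s : (inr s \in Tge S J) = (s \in J).
Proof.
rewrite !inE; apply/orP/idP => [[/imsetP[//]|/imsetP[q qJ [->]//]]|sJ].
by right; apply: imset_f.
Qed.

Lemma TgeS (J K : {set gT}) : J \subset K -> Tge S J \subset Tge S K.
Proof.
move=> JK; apply/fintype.subsetP => -[t|s]; rewrite ?in_Tge_inl ?in_Tge_inr.
  by case/andP=> -> /=; apply: fintype.subsetP (genS JK) _.
exact: fintype.subsetP JK s.
Qed.

Lemma sigmaK s : s \in S -> involutive (sigma s).
Proof.
move=> sS [t|r] /=; last by have [->|/negPf rs] := eqVneq r s; rewrite /= ?eqxx ?rs.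
have [->|ts] := eqVneq t s; rewrite /= ?eqxx //.
rewrite -[X in _ == X](mul1g s) (inj_eq (mulIg s)) -eq_invg_mul invS // eq_sym (negPf ts).
by rewrite !mulgA mulss // mul1g -mulgA mulss // mulg1.
Qed.

Lemma sigma_Tge (J : {set gT}) s x : J \subset S -> s \in J ->
  (sigma s x \in Tge S J) = (x \in Tge S J).
Proof.
move=> JS sJ; have sS := fintype.subsetP JS s sJ.
suff imp y : y \in Tge S J -> sigma s y \in Tge S J.
  by apply/idP/idP => /imp //; rewrite sigmaK.
have sG := mem_gen sJ; case: y => [t|r] /=; rewrite ?in_Tge_inl ?in_Tge_inr.
  case/andP=> tT tJ; have [_|ts] := eqVneq t s; first by rewrite in_Tge_inr.
  by rewrite in_Tge_inl reflection_conjS // (groupM (groupM sG tJ) sG).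
by move=> rJ; case: ifP => _; rewrite ?in_Tge_inl ?in_Tge_inr ?simple_reflection.
Qed.

Definition letters (a : seq gT) : {set gT} := [set r in a]%SET.

Lemma in_letters a r : (r \in letters a) = (r \in a).
Proof. by rewrite inE. Qed.

Lemma lettersS a : {subset a <= S} -> letters a \subset S.
Proof. by move=> aS; apply/fintype.subsetP => r; rewrite in_letters => /aS. Qed.

Lemma root_supp_seq a t : {subset a <= S} -> inl t \in Tge S (letters a) ->
  forall r, r \notin a -> root t r = 0.
Proof.
move=> aS; rewrite in_Tge_inl => /andP[tT ta] r ra.
by apply: (iffLR (root_supp (lettersS aS) tT)) => //; rewrite in_letters.
Qed.

(** Axiom (i) for [rcompat], inside any standard parabolic subgroup; [root_supp] turns a vanishing
    coordinate into membership. *)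
Lemma rcompat_inr (J : {set gT}) a s y : J \subset S -> s \in J -> y \in Tge S J ->
  rcompat a (inr s) y = (y \in Tge S (J :\ s)%SET).
Proof.
move=> JS sJ; have JsS : (J :\ s)%SET \subset S.
  exact: fintype.subset_trans (finset.subsetDl _ _) JS.
case: y => [t|r] /=; rewrite ?in_Tge_inl ?in_Tge_inr => yJ; rewrite /rcompat /=.
  case/andP: yJ => tT tJ; rewrite tT /=.
  have [_ supp] := root_supp JsS tT; have [suppJ _] := root_supp JS tT.
  apply/eqP/idP => [ts|tJs].
    apply: supp => r; rewrite !inE negb_and negbK => /orP[/eqP->//|].
    exact: suppJ.
  by apply: (iffLR (root_supp JsS tT)) => //; rewrite !inE eqxx.
by rewrite !inE yJ andbT andbT (inj_eq inr_inj) eq_sym.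
Qed.

(** Roots of the parabolic subgroup have no s-coordinate, so the terms that [s] adds to the Euler
    form vanish. *)
Lemma rcompat_cons a s x y : {subset a <= S} -> s \notin a ->
  x \in Tge S (letters a) -> y \in Tge S (letters a) ->
  rcompat (s :: a) x y = rcompat a x y.
Proof.
move=> aS sa; case: x y => [t|r] [t'|r'] // xa ya; rewrite /rcompat /=.
have ts := root_supp_seq aS xa sa; have ts' := root_supp_seq aS ya sa.
by rewrite ts ts' !(mul0r, mulr0, addr0).
Qed.

(** Axiom (ii) for [rcompat]. For two positive roots that stay positive it is [euler_rot]; the other
    cases involve alpha_s, where the Euler form is a single coordinate up to sign. *)
Lemma rcompat_rot a s x y : uniq (s :: a) -> {subset s :: a <= S} ->
  x \in Tge S (letters (s :: a)) -> y \in Tge S (letters (s :: a)) ->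
  rcompat (s :: a) x y = rcompat (rcons a s) (sigma s x) (sigma s y).
Proof.
move=> saU saS xa ya; have sS : s \in S by apply/saS/mem_head.
rewrite /rcompat (inj_eq (inv_inj (sigmaK sS))).
case: (eqVneq x y) => //= xy.
have conjE t : inl t \in Tge S (letters (s :: a)) -> t != s ->
    root (s * t * s)%g = srefl s (root t).
  by rewrite in_Tge_inl => /andP[tT _]; apply: root_conj.
have conj0 t : inl t \in Tge S (letters (s :: a)) -> t != s -> 0 <= srefl s (root t) s.
  move=> ta ts; rewrite -conjE // root_ge0 // reflection_conjS //.
  by move: ta; rewrite in_Tge_inl => /andP[].
have ge0 t r : inl t \in Tge S (letters (s :: a)) -> 0 <= root t r.
  by rewrite in_Tge_inl => /andP[tT _]; apply: root_ge0.
(* Here -alpha_s turns into alpha_s. For the root b of t, one of the two values is -b_s and the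
   other is (s b)_s, which is nonnegative; so the condition is b_s = 0. *)
have neg_pos t : inl t \in Tge S (letters (s :: a)) -> t != s ->
    (root t s == 0) = (0 <= euler (rcons a s) (root s) (root (s * t * s)%g)) &&
                      (0 <= euler (rcons a s) (root (s * t * s)%g) (root s)).
  move=> ta ts; rewrite conjE // (root_simple sS) euler_last_simple // conj0 // andbT.
  rewrite euler_simple_last_srefl ?oppr_ge0 //; last exact: root_supp_seq ta.
  by rewrite eq_le ge0 // andbT.
(* Here alpha_s turns into -alpha_s. The values are b_s, which is nonnegative, and -(s b)_s; so the
   condition is (s b)_s = 0. *)
have pos_neg t : inl t \in Tge S (letters (s :: a)) -> t != s ->
    (0 <= euler (s :: a) (root s) (root t)) && (0 <= euler (s :: a) (root t) (root s)) =
    (root (s * t * s)%g s == 0).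
  move=> ta ts; rewrite conjE // (root_simple sS) euler_simple_first // ge0 // andTb.
  rewrite euler_first_simple //; last exact: root_supp_seq ta.
  by rewrite oppr_ge0 eq_le conj0 // andbT.
case: x y xa ya xy => [t|r] [t'|r'] xa ya xy /=.
- case: (eqVneq t s) => [E|ts]; case: (eqVneq t' s) => [E'|ts'].
  + by rewrite E E' eqxx in xy.
  + by rewrite -(pos_neg t') // E.
  + by rewrite -(pos_neg t) // E' andbC.
  + by rewrite !conjE // !euler_rot //; apply: root_supp_seq.
- case: (eqVneq t s) => [E|ts]; case: (eqVneq r' s) => [E'|rs'].
  + by rewrite E E' eq_sym.
  + by rewrite E (root_simple sS) /simple (negPf rs') eqxx.
  + by rewrite E' neg_pos // andbC.
  + by rewrite conjE // srefl_neq.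
- case: (eqVneq r s) => [E|rs]; case: (eqVneq t' s) => [E'|ts'].
  + by rewrite E E'.
  + by rewrite E neg_pos.
  + by rewrite E' (root_simple sS) /simple (negPf rs) eqxx.
  + by rewrite conjE // srefl_neq.
- case: (eqVneq r s) => [E|rs]; case: (eqVneq r' s) => [E'|rs'] //.
  + by rewrite E E' eqxx in xy.
  + by rewrite (root_simple sS) /simple (negPf rs') eqxx.
  + by rewrite (root_simple sS) /simple (negPf rs) eqxx.
Qed.

(** * Rotation of almost positive roots *)

Lemma root_neq0 t : t \in reflections S -> ~ (forall r, root t r = 0).
Proof.
move=> tT t0; have := form_root (rootP tT); rewrite /form big1 => [/eqP|r _].
  by rewrite eq_sym pnatr_eq0.
by rewrite t0 mul0r.
Qed.

(* The almost positive root x becomes the negative of the leading simple root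
   after finitely many rotations of the word a. *)
Inductive reach : seq gT -> gT + gT -> Prop :=
| ReachHere s a : reach (s :: a) (inr s)
| ReachRot s a x : reach (rcons a s) (sigma s x) -> reach (s :: a) x.

Lemma reach_inr a r : uniq a -> r \in a -> reach a (inr r).
Proof.
move=> aU ra; case/splitPr: ra aU => a1 a2; rewrite cat_uniq /= negb_or.
case/and3P=> _ /andP[ra1 _] _.
elim: a1 a2 ra1 => [|q a1 IH] a2; first by move=> _; apply: ReachHere.
rewrite inE negb_or => /andP[/negPf rq ra1]; apply: ReachRot.
by rewrite /= rq rcons_cat; apply: IH.
Qed.

(** If no negative simple root is ever met, t is never the leading letter, so every rotation is
    plain conjugation and the positive root moves by the linear action. *)
Lemma not_reach_rot a1 a2 t : uniq (a1 ++ a2) -> {subset a1 ++ a2 <= S} ->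
  t \in reflections S -> ~ reach (a1 ++ a2) (inl t) ->
  ~ reach (a2 ++ a1) (inl (t ^ wprod a1)%g) /\
  root (t ^ wprod a1)%g = act (wprod a1)^-1%g (root t).
Proof.
elim: a1 a2 t => [|q a1 IH] a2 t aU aS tT nr.
  by rewrite cats0 big_nil conjg1 invg1 act1.
have qS : q \in S by rewrite aS // mem_head.
have pE : perm_eq (a1 ++ rcons a2 q) (q :: a1 ++ a2).
  by rewrite -rcons_cat perm_rcons.
have aU' : uniq (a1 ++ rcons a2 q) by rewrite (perm_uniq pE).
have aS' : {subset a1 ++ rcons a2 q <= S} by move=> r; rewrite (perm_mem pE) => /aS.
have tq : t != q.
  apply/eqP => tq; apply: nr; apply: ReachRot; rewrite /= tq eqxx.
  by rewrite rcons_cat; apply: reach_inr => //; rewrite (perm_mem pE) mem_head.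
have nr' : ~ reach (a1 ++ rcons a2 q) (inl (q * t * q)%g).
  by move=> re; apply: nr; apply: ReachRot; rewrite /= (negPf tq) rcons_cat.
have [re E] := IH _ _ aU' aS' (reflection_conjS qS tT) nr'.
have tE : (t ^ (q * wprod a1) = (q * t * q) ^ wprod a1)%g.
  by rewrite conjgM [(t ^ q)%g]conjgE (invS qS) mulgA.
rewrite big_cons tE; split; first by rewrite -cat_rcons.
by rewrite E root_conj // invMg (invS qS) actM (actS _ qS).
Qed.

(** The letters are distinct, so each coordinate is changed by one reflection at most; a vector
    fixed by the product is therefore fixed by every letter. *)
Lemma wact_fix a v : uniq a -> wact a v = v -> {in a, forall s, srefl s v = v}.
Proof.
elim: a => //= s a IH /andP[sa aU] fixv.
have av : wact a v = v.
  apply/funext => r; have [->|rs] := eqVneq r s; first by rewrite wact_notin.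
  by rewrite -[in RHS]fixv srefl_neq.
move=> r; rewrite inE => /predU1P[->|]; first by rewrite -{1}av fixv.
exact: IH.
Qed.

Lemma reach_Tge a x : uniq a -> {subset a <= S} -> x \in Tge S (letters a) ->
  reach a x.
Proof.
move=> aU aS; case: x => [t|r]; last first.
  by rewrite in_Tge_inr in_letters; apply: reach_inr.
rewrite in_Tge_inl => /andP[tT ta]; apply: contrapT => nr.
pose c := wprod a; pose b := root t.
have iter k : ~ reach a (inl (t ^ (c ^+ k))%g) /\
    root (t ^ (c ^+ k))%g = act (c ^+ k)^-1%g b.
  elim: k => [|k [nk rk]]; first by rewrite expg0 conjg1 invg1 act1.
  have := @not_reach_rot a [::] _ _ _ (reflection_conj (c ^+ k)%g tT).
  rewrite !cats0 => /(_ aU aS nk) [nk' E].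
  by rewrite expgSr conjgM; split=> //; rewrite E invMg actM rk.
have pos g r : g \in <[c]>%g -> 0 <= act g b r.
  rewrite -groupV => /cycleP[k gk]; rewrite -(invgK g) gk.
  by have [_ <-] := iter k; rewrite root_ge0 // reflection_conj.
(* The sum of b over the powers of c. It is fixed by c, hence by [wact_fix] by the whole parabolic
   subgroup. *)
pose v r := \sum_(g in <[c]>%g) act g b r.
have aG s : s \in a -> s \in <<letters a>>%g by move=> sa; rewrite mem_gen ?in_letters.
have cG : c \in <<letters a>>%g by apply: wprod_gen => s sa; rewrite in_letters.
have cv : wact a v = v.
  rewrite -actE // act_sum; apply/funext => r.
  rewrite [RHS](reindex_inj (mulgI c)) /=; apply: eq_big => g.
    by rewrite groupMl ?cycle_id.
  by rewrite actM.
have fixv g : g \in <<letters a>>%g -> act g v = v.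
  case/gen_word => u [ua <-]; rewrite actE; last by move=> s /ua; rewrite in_letters => /aS.
  elim: u ua => //= s u IH ua; rewrite IH => [|q qu]; last by rewrite ua // inE qu orbT.
  by apply: (wact_fix aU cv); have := ua s (mem_head _ _); rewrite in_letters.
(* The sum of b over the parabolic subgroup is 0: it contains t, and t negates b. *)
pose z r := \sum_(g in <<letters a>>%g) act g b r.
have z0 r : z r = 0.
  suff : z r = - z r by lra.
  rewrite {1}/z (reindex_inj (mulIg t)) /= /z -sumrN; apply: eq_big => g.
    by rewrite groupMr.
  rewrite actM (act_reflection _ (rootP tT)) (form_root (rootP tT)) => _.
  have -> : (fun r => - 2 * root t r + b r) = (fun r => -1 * b r).
    by apply/funext => q; rewrite /b; ring.
  by rewrite actZ mulN1r.
(* Summing the translates of the fixed vector [v] over the parabolic subgroup gives a multiple of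
   [v]; but each summand of [v] contributes [z], which is 0. *)
have v0 r : v r = 0.
  have : \sum_(g in <<letters a>>%g) act g v r = v r *+ #|<<letters a>>%g|.
    by rewrite -sumr_const; apply: eq_bigr => g /fixv ->.
  have -> : \sum_(g in <<letters a>>%g) act g v r = 0; last first.
    by move/esym/eqP; rewrite mulrn_eq0 eqn0Ngt cardG_gt0 => /eqP.
  under eq_bigr => g _ do rewrite act_sum.
  rewrite exchange_big big1 //= => h hc; rewrite -[RHS](z0 r) /z.
  have hG : h \in <<letters a>>%g by apply: fintype.subsetP h hc; rewrite cycle_subG.
  rewrite [RHS](reindex_inj (mulIg h)) /=; apply: eq_big => g; first by rewrite groupMr.
  by rewrite actM.
(* b is one of the summands of [v], all of them nonnegative by [pos], so b would vanish. *)
apply: (root_neq0 tT) => r; apply/eqP; rewrite eq_le root_ge0 // andbT.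
rewrite -(v0 r) /v (bigD1 1%g) ?group1 //= act1 lerDl.
by apply: sumr_ge0 => g /andP[gc _]; apply: pos.
Qed.

(** * Sorting words and their inversions *)

Definition reduced (u : seq gT) : Prop := reduced_word S (wprod u) u.

(** Sorting words of sortable elements without positions: the infinite word is read letter by
    letter, and each letter is either taken and moved to the back, or skipped and deleted for good,
    because the blocks decrease. *)
Inductive sorting : seq gT -> seq gT -> Prop :=
| SortingNil : sorting [::] [::]
| SortingTake s a u :
    sorting (rcons a s) u -> reduced (s :: u) -> sorting (s :: a) (s :: u)
| SortingSkip s a u : sorting a u -> sorting (s :: a) u.

Lemma sorting_sub a u : sorting a u -> {subset u <= a}.
Proof.
elim=> // {}a; last by move=> b {}u _ IH r /IH ra; rewrite inE ra orbT.
move=> b {}u _ IH _ r; rewrite inE => /predU1P[->|/IH]; first exact: mem_head.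
by rewrite mem_rcons.
Qed.

Lemma sorting_reduced a u : sorting a u -> reduced u.
Proof. by elim=> //; split=> //; split. Qed.

Fixpoint invs (u : seq gT) : seq gT :=
  if u is s :: u' then s :: [seq (s * t * s)%g | t <- invs u'] else [::].

Lemma invs_cat u1 u2 : {subset u1 <= S} ->
  invs (u1 ++ u2) = invs u1 ++ [seq (wprod u1 * t * (wprod u1)^-1)%g | t <- invs u2].
Proof.
elim: u1 => [|s u1 IH] uS /=.
  by rewrite -[LHS]map_id; apply: eq_map => t; rewrite big_nil mul1g invg1 mulg1.
have sS : s \in S by rewrite uS // mem_head.
rewrite IH => [|r ru]; last by rewrite uS // inE ru orbT.
rewrite map_cat -map_comp /=; congr (_ :: _ ++ _); apply: eq_map => t /=.
by rewrite big_cons invMg (invS sS) !mulgA.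
Qed.

Lemma invs_mem u t : {subset u <= S} -> t \in invs u ->
  exists u1 s u2, u = u1 ++ s :: u2 /\ t = (wprod u1 * s * (wprod u1)^-1)%g.
Proof.
elim: u t => [|s u IH] //= t uS; have sS := uS _ (mem_head s u).
rewrite inE => /predU1P[->|/mapP[t' t'u ->]].
  by exists [::], s, u; rewrite big_nil mul1g invg1 mulg1.
have uS' : {subset u <= S} by move=> r ru; rewrite uS // inE ru orbT.
have [u1 [q [u2 [-> ->]]]] := IH _ uS' t'u.
by exists (s :: u1), q, u2; rewrite big_cons invMg (invS sS) !mulgA.
Qed.

Lemma invs_Tge a u t : {subset a <= S} -> {subset u <= a} -> t \in invs u ->
  inl t \in Tge S (letters a).
Proof.
move=> aS ua /invs_mem[|u1 [s [u2 [uE ->]]]]; first by move=> r /ua/aS.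
have sa : s \in a by rewrite ua // uE mem_cat mem_head orbT.
have u1a : wprod u1 \in <<letters a>>%g.
  by apply: wprod_gen => r ru; rewrite in_letters ua // uE mem_cat ru.
rewrite in_Tge_inl; apply/andP; split.
  by apply/reflectionP; exists (wprod u1), s; rewrite aS.
by rewrite !groupM ?groupV // mem_gen // in_letters.
Qed.

(** Were s an inversion of [u], the leading s would cancel against a letter of [u], leaving a word
    shorter by two. *)
Lemma invs_head s u : {subset u <= S} -> reduced (s :: u) -> s \notin invs u.
Proof.
move=> uS sred; apply/negP => /(invs_mem uS) [u1 [q [u2 [uE sE]]]].
have qS : q \in S by rewrite uS // uE mem_cat mem_head orbT.
suff /sred.2 : word_of S (wprod (s :: u)) (u1 ++ u2).
  by rewrite uE /= !size_cat /=; lia.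
split=> [r|].
  by rewrite mem_cat => ru; rewrite uS // uE mem_cat inE orbCA ru orbT.
rewrite big_cons uE !big_cat big_cons /= {1}sE.
by rewrite -!mulgA mulKg (mulgA q) mulss // mul1g.
Qed.

(** * The skew Euler form along inversion sequences *)

Definition omega (a : seq gT) (t t' : gT) : R :=
  euler a (root t) (root t') - euler a (root t') (root t).

Definition omega_pos (a : seq gT) (t t' : gT) : bool :=
  (0 <= omega a t t') && ((omega a t t' == 0) ==> (t * t' == t' * t)%g).

Lemma sum_bform_le0 a s (x : gT -> R) : s \in S -> {subset a <= S} -> s \notin a ->
  (forall r, 0 <= x r) -> \sum_(r <- a) x r * bform r s <= 0.
Proof.
move=> sS aS sa x0; rewrite big_seq; apply: sumr_le0 => r ra.
by rewrite mulr_ge0_le0 // bform_le0 ?(aS r) //; apply: contraNneq sa => <-.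
Qed.

(** For the root b of t, omega(alpha_s, b) is minus the sum of b_r * bform r s over [a], hence
    nonnegative. If it is 0, the pairing of b with alpha_s is 2 b_s, so s b has s-coordinate -b_s;
    both roots being positive, b_s = 0 and s fixes b. *)
Lemma omega_pos_first a s t : uniq (s :: a) -> {subset s :: a <= S} ->
  inl t \in Tge S (letters (s :: a)) -> t != s -> omega_pos (s :: a) s t.
Proof.
move=> saU saS ta ts; have sS : s \in S by rewrite saS ?mem_head.
have tT : t \in reflections S by move: ta; rewrite in_Tge_inl => /andP[].
have supp := root_supp_seq saS ta.
have aS : {subset a <= S} by move=> r ra; rewrite saS // inE ra orbT.
have /andP[sa _] := saU.
have le0 := sum_bform_le0 sS aS sa (fun r => root_ge0 r tT).
have pE := pairing_supp sS saU supp; set k := \sum_(r <- a) _ in le0 pE.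
have oE : omega (s :: a) s t = - k.
  rewrite /omega (root_simple sS) euler_simple_first // euler_first_simple //.
  by rewrite /srefl pE eqxx /=; ring.
rewrite /omega_pos oE oppr_ge0 le0 oppr_eq0 /=; apply/implyP => /eqP k0.
have stT := reflection_conjS sS tT; have b0 := root_ge0 s tT.
have := root_ge0 s stT; rewrite (root_conj sS tT ts) /srefl pE k0 eqxx /= => b1.
have p0 : pairing (root t) s = 0 by rewrite pE k0; lra.
have : root (s * t * s)%g = root t.
  by rewrite (root_conj sS tT ts) /srefl p0; apply/funext => r; rewrite mulr0 subr0.
move/(root_inj stT tT) => E; apply/eqP; rewrite -{2}E.
by rewrite -mulgA mulss // mulg1.
Qed.

Lemma omega_pos_rot a s t t' : uniq (s :: a) -> {subset s :: a <= S} ->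
  inl t \in Tge S (letters (s :: a)) -> inl t' \in Tge S (letters (s :: a)) ->
  t != s -> t' != s ->
  omega_pos (s :: a) (s * t * s)%g (s * t' * s)%g = omega_pos (rcons a s) t t'.
Proof.
move=> saU saS ta ta' ts ts'; have sS : s \in S by rewrite saS ?mem_head.
have refT q : inl q \in Tge S (letters (s :: a)) -> q \in reflections S.
  by rewrite in_Tge_inl => /andP[].
have oE : omega (s :: a) (s * t * s)%g (s * t' * s)%g = omega (rcons a s) t t'.
  have supp q : inl q \in Tge S (letters (s :: a)) ->
      forall r, r \notin s :: a -> srefl s (root q) r = 0.
    move=> qa r ra; rewrite srefl_neq ?(root_supp_seq saS qa) //.
    by apply: contraNneq ra => ->; rewrite mem_head.
  rewrite /omega !root_conj ?refT //.
  by rewrite -!(euler_rot sS saU) ?(sreflK _ sS) //; apply: supp.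
rewrite /omega_pos oE; congr (_ && (_ ==> _)).
have sts p q : (s * p * s * (s * q * s) = s * (p * q) * s)%g.
  by rewrite -!mulgA [(s * (s * _))%g]mulgA mulss // mul1g.
by rewrite !sts (inj_eq (mulIg s)) (inj_eq (mulgI s)).
Qed.

Lemma omega_pos_cons a s t t' : {subset a <= S} -> s \notin a ->
  inl t \in Tge S (letters a) -> inl t' \in Tge S (letters a) ->
  omega_pos (s :: a) t t' = omega_pos a t t'.
Proof.
move=> aS sa ta ta'; rewrite /omega_pos /omega /=.
have ts := root_supp_seq aS ta sa; have ts' := root_supp_seq aS ta' sa.
by rewrite ts ts' !(mul0r, mulr0, addr0).
Qed.

Lemma letters_rcons a s : letters (rcons a s) = letters (s :: a).
Proof. by apply/setP => r; rewrite !in_letters mem_rcons. Qed.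

(** A taken letter s puts alpha_s before the rotated inversions, handled by [omega_pos_first] and
    [omega_pos_rot]; a skipped letter means restriction to a parabolic subgroup. *)
Lemma sorting_omega a u : uniq a -> {subset a <= S} -> sorting a u ->
  pairwise (omega_pos a) (invs u).
Proof.
move=> + + sau; elim: sau => {a u} //.
  move=> s a u sau IH sred saU saS.
  have aU : uniq (rcons a s) by rewrite rcons_uniq.
  have aS : {subset rcons a s <= S} by move=> r; rewrite mem_rcons => /saS.
  have ua := sorting_sub sau; have {}IH := IH aU aS.
  have uS : {subset u <= S} by move=> r /ua/aS.
  have sS : s \in S by rewrite saS ?mem_head.
  have uT t : t \in invs u -> inl t \in Tge S (letters (s :: a)).
    by move=> tu; rewrite -letters_rcons; apply: invs_Tge tu.
  have us t : t \in invs u -> t != s.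
    by apply: contraTneq => ->; apply: invs_head.
  rewrite /= pairwise_map; apply/andP; split.
    apply/allP => _ /mapP[t tu ->]; apply: omega_pos_first => //.
      rewrite -[inl _](_ : sigma s (inl t) = _); last by rewrite /= (negPf (us t tu)).
      by rewrite sigma_Tge ?uT ?lettersS // in_letters mem_head.
    apply: contra (us t tu) => /eqP sts; apply/eqP.
    by apply: (mulgI s); apply: (mulIg s); rewrite sts mulss // mul1g.
  apply: sub_in_pairwise IH; last by apply/allP => t tu; exact: tu.
  move=> t t' /= tu tu'; rewrite /= omega_pos_rot ?us ?uT //.
move=> s a u sau IH /andP[sa aU] saS.
have aS : {subset a <= S} by move=> r ra; rewrite saS // inE ra orbT.
have ua := sorting_sub sau; apply: sub_in_pairwise (IH aU aS); last first.
  by apply/allP => t tu; exact: tu.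
by move=> t t' /= tu tu'; rewrite omega_pos_cons ?(invs_Tge aS ua).
Qed.

(** * Last reflections *)

Lemma last_occurrence (r : gT) u : r \in u ->
  exists u1 u2, u = u1 ++ r :: u2 /\ r \notin u2.
Proof.
elim: u => //= q u IH; have [ru _|ru] := boolP (r \in u).
  by have [u1 [u2 [-> ru2]]] := IH ru; exists (q :: u1), u2.
by rewrite inE (negPf ru) orbF => /eqP E; exists [::], u; rewrite -E.
Qed.

Lemma last_reflection_split u1 r u2 : {subset u1 <= S} -> r \notin u2 ->
  last_reflection (u1 ++ r :: u2) r = inl (wprod u1 * r * (wprod u1)^-1)%g.
Proof.
move=> uS ru2; rewrite /last_reflection mem_cat mem_head orbT rev_cat rev_cons.
rewrite cat_rcons index_cat mem_rev (negPf ru2) /= eqxx addn0 size_rev size_cat /= addnK.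
by rewrite take_size_cat // big_cat big_cons /= wprod_rev // mulgA.
Qed.

Lemma last_reflection_notin (u : seq gT) r : r \notin u -> last_reflection u r = inr r.
Proof. by rewrite /last_reflection => /negPf->. Qed.

Lemma last_reflection_invs u r : {subset u <= S} -> r \in u ->
  exists2 t, t \in invs u & last_reflection u r = inl t.
Proof.
move=> uS /last_occurrence[u1 [u2 [uE ru2]]].
have u1S : {subset u1 <= S} by move=> q qu; rewrite uS // uE mem_cat qu.
rewrite uE.
exists (wprod u1 * r * (wprod u1)^-1)%g; last exact: last_reflection_split.
by rewrite invs_cat // mem_cat /= mem_head orbT.
Qed.

(** Prefixing s conjugates the last reflections, none of which is s because [s :: u] is reduced; if
    s is new, its last reflection changes from -s to s. This is what [sigma s] does. *)
Lemma last_reflection_cons s u r : {subset s :: u <= S} -> reduced (s :: u) ->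
  last_reflection (s :: u) r = sigma s (last_reflection u r).
Proof.
move=> suS sred; have sS : s \in S by rewrite suS ?mem_head.
have uS : {subset u <= S} by move=> q qu; rewrite suS // inE qu orbT.
have [ru|ru] := boolP (r \in u).
  have [t tu tE] := last_reflection_invs uS ru.
  have ts : t != s by apply: contraTneq tu => ->; apply: invs_head.
  rewrite tE /= (negPf ts); case/last_occurrence: ru tE => u1 [u2 [uE ru2]].
  have u1S : {subset u1 <= S} by move=> q qu; rewrite uS // uE mem_cat qu.
  rewrite uE last_reflection_split // => -[<-].
  rewrite -cat_cons last_reflection_split //.
    by rewrite big_cons invMg (invS sS) !mulgA.
  by move=> q; rewrite inE => /predU1P[->|/u1S].
rewrite (last_reflection_notin ru) /=; have [E|rs] := eqVneq r s.
  rewrite -(cat0s (s :: u)) E last_reflection_split -?E //.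
  by rewrite big_nil mul1g invg1 mulg1.
by rewrite last_reflection_notin // inE negb_or rs.
Qed.

Definition last_reflections (a u : seq gT) : {set gT + gT} :=
  [set last_reflection u s | s in letters a]%SET.

Lemma last_reflections_take a s u : {subset s :: u <= S} -> reduced (s :: u) ->
  last_reflections (s :: a) (s :: u) = (sigma s @: last_reflections (rcons a s) u)%SET.
Proof.
move=> suS sred; rewrite /last_reflections letters_rcons -imset_comp.
by apply: eq_imset => r; rewrite last_reflection_cons.
Qed.

Lemma last_reflections_skip a s (u : seq gT) : s \notin u ->
  last_reflections (s :: a) u = (inr s |: last_reflections a u)%SET.
Proof.
move=> su; apply/setP => x; rewrite 2!inE; apply/imsetP/orP.
  case=> r; rewrite in_letters inE => /predU1P[-> ->|ra ->].
    by left; rewrite last_reflection_notin.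
  by right; apply: imset_f; rewrite in_letters.
case=> [/eqP->|/imsetP[r]].
  by exists s; rewrite ?last_reflection_notin // in_letters mem_head.
by rewrite in_letters => ra ->; exists r; rewrite ?in_letters ?inE ?ra ?orbT.
Qed.

Lemma inr_last_reflections (a u : seq gT) s : s \in a ->
  (inr s \in last_reflections a u) = (s \notin u).
Proof.
move=> sa; apply/imsetP/idP => [[r _]|su].
  rewrite /last_reflection; case: ifP => // /negbT ru [->] //.
by exists s; rewrite ?in_letters // last_reflection_notin.
Qed.

Lemma last_reflections_Tge a u : {subset a <= S} -> {subset u <= a} ->
  last_reflections a u \subset Tge S (letters a).
Proof.
move=> aS ua; apply/fintype.subsetP => x /imsetP[s]; rewrite in_letters => sa ->.
have uS : {subset u <= S} by move=> r /ua/aS.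
have [su|su] := boolP (s \in u); last first.
  by rewrite last_reflection_notin // in_Tge_inr in_letters.
by have [t tu ->] := last_reflection_invs uS su; apply: invs_Tge tu.
Qed.

(** The first inversion is the first letter q itself, so q commutes with y; conjugation by q then
    carries the hypothesis over to the rest of the word. *)
Lemma invs_commute u y : {subset u <= S} -> y \in S ->
  {in invs u, forall t, t * y = y * t}%g -> {in u, forall z, z * y = y * z}%g.
Proof.
move=> + yS; elim: u => // q u IH uS com.
have qS : q \in S by rewrite uS ?mem_head.
have qy : (q * y = y * q)%g by apply: com; rewrite mem_head.
move=> z; rewrite inE => /predU1P[->//|]; apply: IH.
  by move=> r ru; rewrite uS // inE ru orbT.
move=> t tu; have : (q * t * q)%g \in invs (q :: u).
  by rewrite /= inE; apply/orP; right; apply/mapP; exists t.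
move/com.
rewrite -(mulgA _ q) qy !mulgA -qy -(mulgA _ t) -(mulgA _ t) -!(mulgA q).
by move/mulgI; rewrite !mulgA => /mulIg.
Qed.

(* With s last in the word, omega(alpha_s, -) is nonpositive on positive roots,
   so all inversions after s commute with s. *)
Lemma last_letter_inversion a s u : uniq (s :: a) -> {subset s :: a <= S} ->
  sorting (rcons a s) u -> ~ reduced (s :: u) ->
  inl s \in last_reflections (rcons a s) u.
Proof.
move=> saU saS sau nred; have sS : s \in S by rewrite saS ?mem_head.
have aU : uniq (rcons a s) by rewrite rcons_uniq.
have aS : {subset rcons a s <= S} by move=> r; rewrite mem_rcons => /saS.
have ua := sorting_sub sau; have uS : {subset u <= S} by move=> r /ua/aS.
have /reduced_wordP[_ lu] := sorting_reduced sau.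
have suW : word_of S (wprod (s :: u)) (s :: u).
  by split=> // r; rewrite inE => /predU1P[->|/uS].
have le : (len (wprod (s :: u)) <= len (wprod u))%N.
  have := len_le suW; rewrite /= leq_eqVlt ltnS lu => /predU1P[E|//].
  by case: nred; apply/reduced_wordP; rewrite E /= lu.
(* [s :: u] is not reduced, so the inverse of [wprod u] makes alpha_s nonpositive and s is an
   inversion of [u]. *)
have neg r : act (wprod u)^-1%g (simple s) r <= 0.
  apply: act_simple_le0 => //.
  by rewrite -{1}(invS sS) -invMg !lenV -[(s * _)%g](big_cons _ _ s u xpredT id).
have sT := simple_reflection sS.
have [|u1 [y [u2 [uE sE]]]] := @inversion_of_act_le0 u s uS sT; first by rewrite root_simple.
have yS : y \in S by rewrite uS // uE mem_cat mem_head orbT.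
have u1S : {subset u1 <= S} by move=> r ru; rewrite uS // uE mem_cat ru.
have u2S : {subset u2 <= S} by move=> r ru; rewrite uS // uE mem_cat inE ru !orbT.
pose p := wprod u1.
(* Since s = p y p^-1, an inversion after s commutes with s exactly when its counterpart in the
   suffix, conjugated back by p, commutes with y. *)
have com : {in invs u2, forall t, t * y = y * t}%g.
  move=> t tu; have := sorting_omega aU aS sau.
  have yt : (y * t * y)%g \in [seq (y * t * y)%g | t <- invs u2].
    by apply/mapP; exists t.
  rewrite uE invs_cat // pairwise_cat => /and3P[_ _]; rewrite /= -sE.
  case/andP=> /allP /(_ (p * (y * t * y) * p^-1)%g) + _.
  rewrite (map_f (fun t => p * t * p^-1)%g) // => /(_ isT) /andP[].
  set t' := (p * _ * _)%g => o0 /implyP o1.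
  have t'T : inl t' \in Tge S (letters (rcons a s)).
    apply: (invs_Tge aS ua); rewrite uE invs_cat // mem_cat; apply/orP; right.
    by apply: (map_f (fun t => p * t * p^-1)%g); rewrite /= inE yt orbT.
  have t'R : t' \in reflections S by move: t'T; rewrite in_Tge_inl => /andP[].
  have /eqP : (s * t' == t' * s)%g.
    (* With s last, the s-coordinates cancel in omega(alpha_s, -) and a nonpositive sum over [a]
       remains; as [sorting_omega] gives the other sign, it is 0. *)
    apply: o1; rewrite eq_le o0 andbT /omega (root_simple sS).
    rewrite euler_simple_last // euler_last_simple // addrAC subrr add0r.
    have /andP[sa _] := saU; apply: sum_bform_le0 => //.
      by move=> r ra; rewrite saS // inE ra orbT.
    by move=> r; apply: root_ge0.
  rewrite sE /t' -/p => E.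
  have {}E : (y * (y * t * y) = (y * t * y) * y)%g.
    apply: (mulgI p); apply: (mulIg p^-1%g).
    by move: E; rewrite -!mulgA !mulKg.
  have {}E : (y * y * (t * y) = y * t * (y * y))%g by rewrite -!mulgA in E *.
  by move: E; rewrite (mulss yS) mul1g mulg1.
(* A second y further on would cancel against this one, as every letter in between commutes with y.
   So this is the last y in [u], and s is its last reflection. *)
have yu2 : y \notin u2.
  apply/negP => yu2; have comu := invs_commute u2S yS com.
  case/splitPr: yu2 uE u2S comu {com} => v1 v2 uE u2S comu.
  have v1y : (wprod v1 * y = y * wprod v1)%g.
    have : {in v1, forall z, z * y = y * z}%g.
      by move=> z zv; apply: comu; rewrite mem_cat zv.
    elim: v1 {uE u2S comu} => [|z v1 IH] com; rewrite ?big_nil ?mul1g ?mulg1 //.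
    rewrite big_cons -mulgA IH => [|q qv]; last by rewrite com // inE qv orbT.
    by rewrite !mulgA com ?mem_head.
  have : word_of S (wprod u) (u1 ++ v1 ++ v2).
    split=> [r ru|].
      by rewrite uS // uE; move: ru; rewrite !(mem_cat, inE) => /or3P[]->; rewrite ?orbT.
    rewrite uE !big_cat /= !big_cons !big_cat /= !big_cons.
    have E q : (y * (wprod v1 * (y * q)) = wprod v1 * q)%g.
      by rewrite !mulgA -(mulgA y) v1y !mulgA (mulss yS) mul1g.
    by rewrite E.
  move/len_le; rewrite -lu uE !size_cat /= !size_cat /=; lia.
apply/imsetP; exists y; first by rewrite in_letters ua // uE mem_cat mem_head orbT.
by rewrite uE last_reflection_split // -sE.
Qed.

(** * Clusters *)

(** Stated relative to a subset [J], so that induction on the rank can pass to parabolic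
    subgroups. *)
Definition compatible_in (J : {set gT}) (r : rel (gT + gT)) (C : {set gT + gT}) : bool :=
  (C \subset Tge S J) && [forall x in C, forall y in C, (x != y) ==> r x y].

Lemma compatible_inP (J : {set gT}) (r : rel (gT + gT)) (C : {set gT + gT}) :
  reflect (C \subset Tge S J /\ forall x y, x \in C -> y \in C -> x != y -> r x y)
          (compatible_in J r C).
Proof.
apply: (iffP andP) => -[CT Cr]; split=> //.
  by move=> x y xC yC; move: Cr => /forall_inP/(_ x xC)/forall_inP/(_ y yC)/implyP.
by apply/forall_inP => x xC; apply/forall_inP => y yC; apply/implyP; apply: Cr.
Qed.

Definition rcluster (a : seq gT) : pred {set gT + gT} :=
  maxset (compatible_in (letters a) (rcompat a)).

Lemma sigma_imsetK s (C : {set gT + gT}) : s \in S -> (sigma s @: (sigma s @: C))%SET = C.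
Proof.
move=> sS; rewrite -imset_comp -[RHS]imset_id; apply: eq_imset => x /=.
exact: sigmaK.
Qed.

Lemma compatible_in_rot a s (C : {set gT + gT}) : uniq (s :: a) -> {subset s :: a <= S} ->
  compatible_in (letters (rcons a s)) (rcompat (rcons a s)) (sigma s @: C)%SET =
  compatible_in (letters (s :: a)) (rcompat (s :: a)) C.
Proof.
move=> saU saS; have sS : s \in S by rewrite saS ?mem_head.
have JS := lettersS saS; have sJ : s \in letters (s :: a) by rewrite in_letters mem_head.
rewrite letters_rcons; apply/compatible_inP/compatible_inP => -[CT Cr].
  have {}CT : C \subset Tge S (letters (s :: a)).
    apply/fintype.subsetP => x xC; rewrite -(sigma_Tge _ JS sJ).
    by rewrite (fintype.subsetP CT) ?imset_f.
  split=> // x y xC yC xy; rewrite rcompat_rot ?(fintype.subsetP CT) //.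
  by apply: Cr; rewrite ?imset_f // (inj_eq (inv_inj (sigmaK sS))).
split=> [|x y /imsetP[x' xC ->] /imsetP[y' yC ->] xy].
  by apply/fintype.subsetP => x /imsetP[y yC ->]; rewrite sigma_Tge // (fintype.subsetP CT).
rewrite -rcompat_rot ?(fintype.subsetP CT) // Cr //.
by apply: contraNneq xy => ->.
Qed.

Lemma rcluster_rot a s (C : {set gT + gT}) : uniq (s :: a) -> {subset s :: a <= S} ->
  rcluster (rcons a s) (sigma s @: C)%SET = rcluster (s :: a) C.
Proof.
move=> saU saS; have sS : s \in S by rewrite saS ?mem_head.
apply/maxsetP/maxsetP; rewrite compatible_in_rot // => -[Cc Cmax]; split=> // D Dc CD.
  rewrite -(sigma_imsetK D sS) (Cmax (sigma s @: D)%SET) ?sigma_imsetK ?compatible_in_rot //.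
  exact: imsetS.
rewrite -(sigma_imsetK D sS) (Cmax (sigma s @: D)%SET) //.
  by rewrite -compatible_in_rot // sigma_imsetK.
by rewrite -(sigma_imsetK C sS) imsetS.
Qed.

Lemma letters_consD a s : s \notin a -> (letters (s :: a) :\ s)%SET = letters a.
Proof.
move=> sa; apply/setP => r; rewrite !inE; have [->|//] := eqVneq r s.
by rewrite (negPf sa).
Qed.

Lemma Tge_consT a s : Tge S (letters a) \subset Tge S (letters (s :: a)).
Proof. by apply: TgeS; apply/fintype.subsetP => r; rewrite !in_letters inE orbC => ->. Qed.

Lemma rcompat_head a s x : uniq (s :: a) -> {subset s :: a <= S} ->
  x \in Tge S (letters (s :: a)) ->
  rcompat (s :: a) (inr s) x = (x \in Tge S (letters a)).
Proof.
move=> /andP[sa _] saS xT; rewrite (@rcompat_inr (letters (s :: a))) ?lettersS //.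
  by rewrite letters_consD.
by rewrite in_letters mem_head.
Qed.

(** Everything compatible with -s and distinct from it lies in the parabolic subgroup of [a], where
    [rcompat_cons] identifies the two relations. *)
Lemma compatible_in_cons a s (C : {set gT + gT}) : uniq (s :: a) -> {subset s :: a <= S} ->
  inr s \notin C ->
  compatible_in (letters (s :: a)) (rcompat (s :: a)) (inr s |: C)%SET =
  compatible_in (letters a) (rcompat a) C.
Proof.
move=> saU saS sC; have /andP[sa _] := saU.
have aS : {subset a <= S} by move=> r ra; rewrite saS // inE ra orbT.
have aT := fintype.subsetP (Tge_consT a s).
apply/compatible_inP/compatible_inP => -[CT Cr].
  have {}CT : C \subset Tge S (letters a).
    apply/fintype.subsetP => x xC; have xC' : x \in (inr s |: C)%SET by rewrite inE xC orbT.
    rewrite -(@rcompat_head a s) //; last exact: (fintype.subsetP CT).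
    by apply: Cr; rewrite ?inE ?eqxx ?xC ?orbT //; apply: contraNneq sC => ->.
  split=> // x y xC yC xy.
  rewrite -(@rcompat_cons a s) ?(fintype.subsetP CT) //.
  by apply: Cr; rewrite ?inE ?xC ?yC ?orbT.
split=> [|x y].
  apply/fintype.subsetP => x; rewrite in_setU1 => /predU1P[->|/(fintype.subsetP CT)/aT //].
  by rewrite in_Tge_inr in_letters mem_head.
rewrite !inE => /predU1P[->|xC] /predU1P[->|yC] xy; first by rewrite eqxx in xy.
- by rewrite rcompat_head ?aT ?(fintype.subsetP CT).
- by rewrite rcompatC rcompat_head ?aT ?(fintype.subsetP CT).
by rewrite rcompat_cons ?(fintype.subsetP CT) // Cr.
Qed.

Lemma rcluster_cons a s (C : {set gT + gT}) : uniq (s :: a) -> {subset s :: a <= S} ->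
  inr s \notin C -> rcluster (s :: a) (inr s |: C)%SET = rcluster a C.
Proof.
move=> saU saS sC; have /andP[sa _] := saU.
apply/maxsetP/maxsetP; rewrite compatible_in_cons // => -[Cc Cmax]; split=> // D Dc CD.
  have sD : inr s \notin D.
    apply/negP => sD; case/compatible_inP: Dc => /fintype.subsetP/(_ _ sD) + _.
    by rewrite in_Tge_inr in_letters (negPf sa).
  rewrite -(finset.setU1K sD) (Cmax (inr s |: D)%SET) ?finset.setU1K ?compatible_in_cons //.
  exact: finset.setUS.
have sD : inr s \in D := fintype.subsetP CD _ (finset.setU11 _ _).
rewrite -(finset.setD1K sD); congr (_ |: _)%SET; apply: Cmax.
  by rewrite -(@compatible_in_cons a s) ?finset.setD1K // !inE eqxx.
by rewrite finset.subsetD1 sC andbT (fintype.subset_trans _ CD) // finset.subsetUr.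
Qed.

Lemma inr_notin_last_reflections a u s : {subset a <= S} -> {subset u <= a} ->
  s \notin a -> inr s \notin last_reflections a u.
Proof.
move=> aS ua; apply: contra => /(fintype.subsetP (last_reflections_Tge aS ua)).
by rewrite in_Tge_inr in_letters.
Qed.

(** Induction on the sorting word: a taken letter is undone by [rcluster_rot], a skipped one by
    [rcluster_cons]. *)
Lemma sorting_rcluster a u : uniq a -> {subset a <= S} -> sorting a u ->
  rcluster a (last_reflections a u).
Proof.
move=> + + sau; elim: sau => {a u}.
(* Rank 0: the empty set is maximal, since a reflection of the trivial subgroup would have zero
   root. *)
- move=> _ _; apply/maxsetP; split.
    apply/compatible_inP; split=> [|x y /imsetP[r]]; last by rewrite in_letters.
    by apply/fintype.subsetP => x /imsetP[r]; rewrite in_letters.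
  move=> D /compatible_inP[/fintype.subsetP DT _] _; apply/setP => -[t|r]; last first.
    apply/idP/imsetP => [/DT|[q]]; last by rewrite in_letters.
    by rewrite in_Tge_inr in_letters.
  apply/idP/imsetP => [/DT|[q]]; last by rewrite in_letters.
  rewrite in_Tge_inl => /andP[tT t1].
  have nilS : letters [::] \subset S by apply: lettersS.
  case: (root_neq0 tT) => r; apply: (iffLR (root_supp nilS tT)) => //.
  by rewrite in_letters.
- move=> s a u sau IH sred saU saS.
  have aS : {subset rcons a s <= S} by move=> r; rewrite mem_rcons => /saS.
  have ua := sorting_sub sau.
  rewrite last_reflections_take //; last first.
    by move=> r; rewrite inE => /predU1P[->|/ua/aS //]; rewrite saS ?mem_head.
  rewrite -rcluster_rot // sigma_imsetK ?saS ?mem_head //.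
  by apply: IH; rewrite ?rcons_uniq.
move=> s a u sau IH saU saS; have /andP[sa aU] := saU.
have aS : {subset a <= S} by move=> r ra; rewrite saS // inE ra orbT.
have ua := sorting_sub sau.
rewrite last_reflections_skip; last by apply: contra sa; apply: ua.
by rewrite rcluster_cons ?IH // inr_notin_last_reflections.
Qed.

(** -s belongs to the set exactly when s is skipped, so the set reveals whether the leading letter
    is taken; then induct on the rotated or restricted set. *)
Lemma last_reflections_inj a u v : uniq a -> {subset a <= S} ->
  sorting a u -> sorting a v -> last_reflections a u = last_reflections a v -> u = v.
Proof.
move=> + + sau; elim: sau v => {a u} [|s a u sau IH sred|s a u sau IH] v.
- by move=> _ _ sv; inversion sv.
- move=> saU saS sv; have sS : s \in S by rewrite saS ?mem_head.
  have aS : {subset rcons a s <= S} by move=> r; rewrite mem_rcons => /saS.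
  have suS w : sorting (rcons a s) w -> {subset s :: w <= S}.
    by move=> /sorting_sub wa r; rewrite inE => /predU1P[->//|/wa/aS].
  inversion sv as [|s' a' v' sav sredv|s' a' v' sav]; subst.
    rewrite (last_reflections_take _ (suS _ sau) sred).
    rewrite (last_reflections_take _ (suS _ sav) sredv) => E.
    suff -> : u = v' by [].
    apply: IH; rewrite ?rcons_uniq //.
    by rewrite -[LHS](sigma_imsetK _ sS) E sigma_imsetK.
  move=> E; have := congr1 (fun C : {set gT + gT} => inr s \in C) E.
  rewrite !inr_last_reflections ?mem_head //= => /esym/negbT; rewrite negbK.
  by move/(sorting_sub sav) => sa; rewrite /= sa in saU.
move=> saU saS sv; have /andP[sa aU] := saU.
have aS : {subset a <= S} by move=> r ra; rewrite saS // inE ra orbT.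
have snot w : sorting a w -> s \notin w.
  by move=> saw; apply: contra sa; apply: sorting_sub.
inversion sv as [|s' a' v' sav sredv|s' a' v' sav]; subst.
  move=> E; have := congr1 (fun C : {set gT + gT} => inr s \in C) E.
  by rewrite !inr_last_reflections ?mem_head //= snot.
rewrite !last_reflections_skip ?snot // => E; apply: IH => //.
have sn w : sorting a w -> inr s \notin last_reflections a w.
  by move=> /sorting_sub wa; apply: inr_notin_last_reflections.
by rewrite -(finset.setU1K (sn _ sau)) E finset.setU1K ?sn.
Qed.

(** Induction on the rank, and within a rank on the rotations that bring a chosen element of C to
    the leading negative simple root. If -s lies in C, delete s and lower the rank; otherwise rotate
    and prefix s to the word obtained. *)
Lemma rcluster_surj a C : uniq a -> {subset a <= S} -> rcluster a C ->
  exists2 u, sorting a u & last_reflections a u = C.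
Proof.
move: {2}(size a) (erefl (size a)) => n; elim: n a C => [|n IHn] a C.
  move/size0nil => -> _ _ Cc; exists [::]; first exact: SortingNil.
  have /maxsetP[Cc' _] := Cc; have /maxsetP[_ max] :
    rcluster [::] (last_reflections [::] [::]).
    by apply: sorting_rcluster => //; apply: SortingNil.
  apply/esym/max => //; apply/fintype.subsetP => x /imsetP[r].
  by rewrite in_letters.
move=> sz aU aS Cc.
have step s b : size (s :: b) = n.+1 -> uniq (s :: b) -> {subset s :: b <= S} ->
    forall D, rcluster (s :: b) D -> inr s \in D ->
    exists2 u, sorting (s :: b) u & last_reflections (s :: b) u = D.
  move=> [sz'] sbU sbS D Dc sD; have /andP[sb bU] := sbU.
  have bS : {subset b <= S} by move=> r rb; rewrite sbS // inE rb orbT.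
  have sD' : inr s \notin (D :\ inr s)%SET by rewrite !inE eqxx.
  have [|u sbu uD] := IHn b (D :\ inr s)%SET sz' bU bS.
    by rewrite -(@rcluster_cons b s) // finset.setD1K.
  exists u; first exact: SortingSkip.
  rewrite last_reflections_skip ?uD ?finset.setD1K //.
  by apply: contra sb; apply: sorting_sub.
(* The empty set is not a cluster in positive rank, since -s can be added. *)
have [x xC] : exists x, x \in C.
  apply/set0Pn/negP => /eqP C0; have /maxsetP[_ max] := Cc.
  case: a sz aU aS {Cc} max => // s a _ aU aS max.
  have /setP/(_ (inr s)) : [set inr s]%SET = C :> {set gT + gT}.
    apply: max; last by rewrite C0 finset.sub0set.
    apply/compatible_inP; split.
      by rewrite finset.sub1set in_Tge_inr in_letters mem_head.
    by move=> p q /finset.set1P-> /finset.set1P->; rewrite eqxx.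
  by rewrite C0 !inE eqxx.
have /reach_Tge re : x \in Tge S (letters a).
  by have /maxsetP[/compatible_inP[/fintype.subsetP CT _] _] := Cc; apply: CT.
have {re} := re aU aS => re.
elim: re C sz aU aS Cc xC => [s b|s b {}x re IH] C sz aU aS Cc xC; first exact: step.
have [sC|sC] := boolP (inr s \in C); first exact: step.
have sS : s \in S by rewrite aS ?mem_head.
have bS : {subset rcons b s <= S} by move=> r; rewrite mem_rcons => /aS.
have [|||||u sbu uC] := IH (sigma s @: C)%SET.
- by rewrite size_rcons -sz.
- by rewrite rcons_uniq.
- exact: bS.
- by rewrite rcluster_rot.
- exact: imset_f.
(* Otherwise s would belong to the rotated cluster by [last_letter_inversion], and so -s to C. *)
have sred : reduced (s :: u).
  apply: contrapT => nred; move/negP: sC; apply.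
  have := last_letter_inversion aU aS sbu nred; rewrite uC => /imsetP[y yC].
  by move/(congr1 (sigma s)); rewrite (sigmaK sS) /= eqxx => ->.
exists (s :: u); first exact: SortingTake.
rewrite last_reflections_take ?uC ?sigma_imsetK //.
by move=> r; rewrite inE => /predU1P[->//|/(sorting_sub sbu)/bS].
Qed.

(** * Sorting positions *)

Lemma sorted_map_mono (f : nat -> nat) p : {mono f : i j / (i <= j)%N} ->
  sorted ltn (map f p) = sorted ltn p.
Proof. by move=> fm; rewrite sorted_map; apply: eq_sorted => i j /=; rewrite !ltnNge fm. Qed.

Lemma lexi_map_mono (f : nat -> nat) (p q : seq nat) :
  {mono f : i j / (i <= j)%N} ->
  ((map f p : seqlexi nat) <= (map f q : seqlexi nat))%O =
  ((p : seqlexi nat) <= (q : seqlexi nat))%O.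
Proof.
move=> fm; elim: p q => [|i p IH] [|j q] //=.
by rewrite !lexi_cons !leEnat !fm IH.
Qed.

Lemma cinfty_rcons (s : gT) a i : cinfty (rcons a s) i = cinfty (s :: a) i.+1.
Proof.
rewrite /cinfty size_rcons /= -[i.+1]addn1 -modnDml.
have := ltn_pmod i (ltn0Sn (size a)); set r := (i %% _)%N.
rewrite ltnS leq_eqVlt => /predU1P[->|ra].
  by rewrite addn1 modnn nth_rcons ltnn eqxx.
by rewrite modn_small addn1 ?ltnS //= nth_rcons ra.
Qed.

(* Position in (s a)^oo of the i-th letter of a^oo, with n the size of a. *)
Definition skip (n i : nat) : nat := (i + i %/ n).+1.
(** For j not divisible by n+1, exactly j / (n+1) + 1 earlier positions are occupied by s; they are
    subtracted. *)
Definition unskip (n j : nat) : nat := (j - j %/ n.+1).-1.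

Lemma skip_mono n : {mono skip n : i j / (i <= j)%N}.
Proof.
apply: leq_mono => i j ij; rewrite /skip ltnS.
by rewrite (leq_trans (_ : _ < j + i %/ n)%N) ?ltn_add2r // leq_add2l leq_div2r // ltnW.
Qed.

Lemma skipE n i : skip n i = (i %/ n * n.+1 + (i %% n).+1)%N.
Proof. by rewrite /skip {1}(divn_eq i n); lia. Qed.

Lemma skipD n i : (0 < n)%N -> skip n (i + n) = (skip n i + n.+1)%N.
Proof. by move=> n0; rewrite /skip divnDr // divnn n0; lia. Qed.

Lemma unskipK n j : (0 < n)%N -> (j %% n.+1 != 0)%N -> skip n (unskip n j) = j.
Proof.
move=> n0 jn; have := ltn_pmod j (ltn0Sn n); have := divn_eq j n.+1.
set q := (j %/ _)%N; set r := (j %% _)%N in jn * => jE rn.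
have -> : unskip n j = (q * n + r.-1)%N by rewrite /unskip -/q jE; lia.
rewrite skipE divnMDl // modnMDl divn_small ?modn_small; lia.
Qed.

Lemma cinfty_skip (s : gT) a i : (0 < size a)%N ->
  cinfty (s :: a) (skip (size a) i) = cinfty a i.
Proof.
move=> a0; rewrite /cinfty skipE modnMDl modn_small //.
by rewrite ltnS ltn_pmod.
Qed.

Lemma cinfty_div (s : gT) a k : cinfty (s :: a) (k * (size a).+1) = s.
Proof. by rewrite /cinfty /= modnMl. Qed.

Lemma oneNS : 1%g \notin S.
Proof. by apply/negP => /S2; rewrite order1. Qed.

(** For the empty word [cinfty] takes the default value 1, which is not in [S]. *)
Lemma cinfty_inS (a : seq gT) i : cinfty a i \in S -> (0 < size a)%N.
Proof. by case: a => //; rewrite /cinfty nth_nil (negPf oneNS). Qed.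

Lemma subword_shift (s : gT) a q :
  subword (s :: a) (map succn q) = subword (rcons a s) q.
Proof. by rewrite /subword -map_comp; apply: eq_map => i; rewrite /= cinfty_rcons. Qed.

Lemma subword_skip (s : gT) a q : {subset subword a q <= S} ->
  subword (s :: a) (map (skip (size a)) q) = subword a q.
Proof.
move=> qS; rewrite /subword -map_comp; apply/eq_in_map => i iq /=.
by rewrite cinfty_skip // (@cinfty_inS _ i) // qS // map_f.
Qed.

Lemma positive_positions p : 0%N \notin p -> exists q, p = map succn q.
Proof.
move=> p0; exists (map predn p); rewrite -map_comp -[LHS]map_id.
by apply/eq_in_map => -[ip|//]; rewrite ip in p0.
Qed.

Lemma reduced_word_size w u v : reduced_word S w u -> word_of S w v ->
  size v = size u -> reduced_word S w v.
Proof. by move=> /reduced_wordP[_ uw] wv vu; apply/reduced_wordP; rewrite vu. Qed.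

Lemma word_of_cons s w u : s \in S -> word_of S w (s :: u) <-> word_of S (s * w)%g u.
Proof.
move=> sS; split=> -[uS uw]; split.
- by move=> r ru; rewrite uS // inE ru orbT.
- by rewrite -uw big_cons mulgA mulss // mul1g.
- by move=> r; rewrite inE => /predU1P[->|/uS].
- by rewrite big_cons uw mulgA mulss // mul1g.
Qed.

Lemma reduced_word_cons s w u : s \in S -> reduced_word S w (s :: u) ->
  reduced_word S (s * w)%g u.
Proof.
move=> sS [wu umin]; split; first exact/word_of_cons.
by move=> v /(word_of_cons _ _ sS)/umin.
Qed.

(** As w has a reduced word beginning with s, subwords using position 0 come lexicographically
    before all later starts, and among them minimality is a matter of the tails. *)
Lemma sorting_positions_take s a w q : s \in S ->
  (exists2 u, reduced_word S w (s :: u) & reduced_word S (s * w)%g u) ->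
  sorting_positions S (rcons a s) (s * w)%g q <->
  sorting_positions S (s :: a) w (0%N :: map succn q).
Proof.
move=> sS [u wu swu].
have red q' : reduced_positions S (rcons a s) (s * w)%g q' <->
    reduced_positions S (s :: a) w (0%N :: map succn q').
  have so : sorted ltn (0%N :: map succn q') = sorted ltn q'.
    rewrite /= path_sortedE; last exact: ltn_trans.
    by rewrite all_map all_predT /= sorted_map_mono.
  rewrite /reduced_positions so /= subword_shift.
  have -> : cinfty (s :: a) 0 = s by rewrite -(cinfty_div s a 0) mul0n.
  split=> -[? qr]; split=> //; last exact: reduced_word_cons.
  apply: reduced_word_size wu _ _; first by apply/word_of_cons => //; case: qr.
  have /reduced_wordP[_ E1] := qr; have /reduced_wordP[_ E2] := swu.
  by rewrite /= E1 E2.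
have le q1 q2 : ((0%N :: map succn q1 : seqlexi nat) <= (0%N :: map succn q2 : seqlexi nat))%O =
    ((q1 : seqlexi nat) <= (q2 : seqlexi nat))%O.
  by rewrite lexi_cons lexx /= lexi_map_mono.
split=> -[/red qr qmin]; split=> //.
  move=> [|[|i] q'] q'r.
  - have [_ /reduced_wordP[_ /esym]] := q'r.
    by have /reduced_wordP[_ <-] := wu.
  - have [|q3 q3E] := @positive_positions q'.
    + have [+ _] := q'r; rewrite /= path_sortedE; last exact: ltn_trans.
      by case/andP => /allP q'0 _; apply/negP => /q'0.
    by rewrite q3E le; apply: qmin; apply/red; rewrite -q3E.
  by rewrite lexi_cons !leEnat leq0n.
by move=> q' /red/qmin; rewrite le.
Qed.

(** No reduced word of w contains s, so its positions avoid the multiples of the period, and [skip]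
    is an order embedding onto the remaining ones. *)
Lemma sorting_positions_skip s a w q :
  (forall u, reduced_word S w u -> s \notin u) -> {subset subword a q <= S} ->
  sorting_positions S a w q <->
  sorting_positions S (s :: a) w (map (skip (size a)) q).
Proof.
move=> sw qS.
have red q' : {subset subword a q' <= S} -> reduced_positions S a w q' <->
    reduced_positions S (s :: a) w (map (skip (size a)) q').
  move=> q'S; rewrite /reduced_positions subword_skip // sorted_map_mono //.
  exact: skip_mono.
have le q1 q2 : ((map (skip (size a)) q1 : seqlexi nat) <=
      (map (skip (size a)) q2 : seqlexi nat))%O =
    ((q1 : seqlexi nat) <= (q2 : seqlexi nat))%O.
  exact/lexi_map_mono/skip_mono.
split=> -[/(red _ qS) qr qmin]; split=> // q'; last first.
  move=> q'r; rewrite -le; apply: qmin; apply/red => //.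
  by case: q'r => _ [[]].
move=> q'r; have [q'so q'w] := q'r; have [[q'S _] _] := q'w.
have mod0 j : j \in q' -> (j %% (size a).+1 != 0)%N.
  move=> jq; apply/eqP => j0; have /negP := sw _ q'w; apply.
  apply/mapP; exists j => //.
  by rewrite (divn_eq j (size a).+1) j0 addn0 cinfty_div.
(* If [a] is empty, every position carries s and [unskip] has no inverse property; then [q'] must be
   empty. *)
have a0 : (0 < size a)%N \/ q' = [::].
  have [a0|] := posnP (size a); last by left.
  right; case: q' mod0 {q'r q'so q'w q'S} => // j q' /(_ j (mem_head _ _)).
  by rewrite a0 modn1.
have q'E : q' = map (skip (size a)) (map (unskip (size a)) q').
  case: a0 => [a0|->//]; rewrite -map_comp -[LHS]map_id; apply/eq_in_map => j jq /=.
  by rewrite unskipK ?mod0.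
rewrite q'E le; apply: qmin; apply/red; last by rewrite -q'E.
move=> r /mapP[i /mapP[j jq iE] ->]; case: a0 => [a0|q0]; last by rewrite q0 in jq.
rewrite -(cinfty_skip s) // iE unskipK ?mod0 //.
by apply: q'S; apply: map_f.
Qed.

(** Decreasing blocks in terms of positions: adding [size a] gives the same letter one block
    later. *)
Definition nested (a : seq gT) (p : seq nat) : Prop :=
  forall i, (i + size a)%N \in p -> i \in p.

Lemma nested_take s a q : nested (s :: a) (0%N :: map succn q) <-> nested (rcons a s) q.
Proof.
have mS j : (j.+1 \in 0%N :: map succn q) = (j \in q).
  by rewrite inE /= mem_map //; apply: succn_inj.
rewrite /nested size_rcons /=; split=> nq i.
  by move=> iq; rewrite -mS; apply: nq; rewrite addSn mS.
by case: i => [|i]; rewrite ?mem_head // addSn !mS; apply: nq.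
Qed.

Lemma nested_skip s a q : {subset subword a q <= S} ->
  nested (s :: a) (map (skip (size a)) q) <-> nested a q.
Proof.
have inj : injective (skip (size a)).
  move=> i j ij; apply/eqP; rewrite eqn_leq.
  by rewrite -(skip_mono (size a) i j) -(skip_mono (size a) j i) ij leqnn.
move=> qS; have a0 i : i \in q -> (0 < size a)%N.
  by move=> iq; apply: (@cinfty_inS _ i); apply/qS/map_f.
split=> nq i /=.
  move=> iq; rewrite -(mem_map inj); apply: nq.
  by rewrite -skipD ?(a0 _ iq) // mem_map.
case/mapP=> j jq iE; have an := a0 _ jq.
have ja : (size a <= j)%N.
  rewrite leqNgt; apply/negP => lt; move: iE; rewrite /skip divn_small //=; lia.
have -> : i = skip (size a) (j - size a)%N.
  by move: iE; rewrite -{1}(subnK ja) skipD //= => /addIn.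
by apply: map_f; apply: nq; rewrite subnK.
Qed.

(** As [a] has no repeated letter, a letter and its block determine the position. *)
Lemma blocks_nested a p : uniq a -> {subset subword a p <= S} ->
  (forall k, block a p k.+1 \subset block a p k) <-> nested a p.
Proof.
move=> aU pS; have pa i : i \in p -> (0 < size a)%N.
  by move=> ip; apply: (@cinfty_inS _ i); apply/pS/map_f.
have blockP k x : x \in block a p k <->
    exists i, [/\ i \in p, (i %/ size a)%N = k & cinfty a i = x].
  rewrite inE; split=> [/mapP[i]|[i [ip ik <-]]].
    by rewrite mem_filter => /andP[/eqP ik ip] ->; exists i.
  by apply: map_f; rewrite mem_filter ip ik eqxx.
split=> [sub i ip|nest k].
  have a0 := pa _ ip.
  have /(fintype.subsetP (sub _))/blockP[j [jp jk jE]] :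
      cinfty a i \in block a p (i %/ size a).+1.
    apply/blockP; exists (i + size a)%N; split=> //.
      by rewrite divnDr // divnn a0 addn1.
    by rewrite /cinfty modnDr.
  have /eqP : nth 1%g a (j %% size a) = nth 1%g a (i %% size a) by [].
  rewrite nth_uniq ?ltn_pmod // => /eqP ji.
  by rewrite (divn_eq i (size a)) -ji -jk -divn_eq.
apply/fintype.subsetP => x /blockP[i [ip ik <-]]; have a0 := pa _ ip.
have ia : (size a <= i)%N by rewrite -(divn_gt0 i a0) ik.
apply/blockP; exists (i - size a)%N; split; first by apply: nest; rewrite subnK.
  by apply/eqP; rewrite -eqSS -ik -{2}(subnK ia) divnDr // divnn a0 addn1.
by rewrite /cinfty -[in RHS](subnK ia) modnDr.
Qed.

Lemma sorting_has_positions a u : uniq a -> {subset a <= S} -> sorting a u ->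
  exists p, [/\ sorting_positions S a (wprod u) p, subword a p = u & nested a p].
Proof.
move=> + + sau; elim: sau => {a u}.
- move=> _ _; exists [::]; rewrite big_nil.
  have r0 : reduced_positions S [::] 1%g [::] by split=> //; split=> //; split; rewrite ?big_nil.
  by split=> //; split=> // q _; rewrite lexi0s.
- move=> s a u sau IH sred saU saS; have sS : s \in S by rewrite saS ?mem_head.
  have aU : uniq (rcons a s) by rewrite rcons_uniq.
  have aS : {subset rcons a s <= S} by move=> r; rewrite mem_rcons => /saS.
  have [q [qs qE qn]] := IH aU aS.
  exists (0%N :: map succn q); split; last exact/nested_take.
    have E : (s * wprod (s :: u))%g = wprod u by rewrite big_cons mulgA mulss // mul1g.
    apply/sorting_positions_take => //; last by rewrite E.
    by exists u => //; rewrite E; apply: sorting_reduced sau.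
  by rewrite /= subword_shift qE; congr (_ :: _).
move=> s a u sau IH /andP[sa aU] saS.
have aS : {subset a <= S} by move=> r ra; rewrite saS // inE ra orbT.
have [q [qs qE qn]] := IH aU aS; have ua := sorting_sub sau.
have qS : {subset subword a q <= S} by rewrite qE => r /ua/aS.
exists (map (skip (size a)) q); split; [|by rewrite subword_skip|exact/nested_skip].
apply: (iffLR (sorting_positions_skip (s := s) _ qS)) => // v uv.
have uG : wprod u \in <<letters a>>%g.
  by apply: wprod_gen => r /ua; rewrite in_letters.
by apply: contra sa => /(reduced_support (lettersS aS) uG uv); rewrite in_letters.
Qed.

(** Position 0 decides. If it is used, s is taken and the other positions shift down; if not,
    [nested] rules out every multiple of the period, so s never occurs and is skipped. *)
Lemma positions_sorting a w p : uniq a -> {subset a <= S} ->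
  sorting_positions S a w p -> nested a p -> sorting a (subword a p).
Proof.
(* Taking a letter shortens [p] and keeps the length of [a]; skipping one shortens [a]. *)
have [n] := ubnP (size a + size p)%N; elim: n a w p => // n IH [|s a] w p.
  move=> _ _ _ [[_ [[pS _] _]] _] _; case: p pS => [|i p] pS; first exact: SortingNil.
  by have := pS _ (mem_head _ _); rewrite /cinfty nth_nil (negPf oneNS).
rewrite /= !ltnS => pn saU saS pw pnest; have sS : s \in S by rewrite saS ?mem_head.
have [[pso pr] pmin] := pw; have [[pS pE] _] := pr.
have [p0|p0] := boolP (0%N \in p).
  have {p0} [q qE] : exists q, p = 0%N :: map succn q.
    case: p pso p0 {pn pw pnest pr pmin pS pE} => // i p.
    rewrite /= path_sortedE; last exact: ltn_trans.
    case/andP => /allP ip pso; rewrite inE => /predU1P[<-|/ip//].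
    by have [|q ->] := @positive_positions p; [apply/negP => /ip|exists q].
  have subE : subword (s :: a) p = s :: subword (rcons a s) q.
    by rewrite qE /= subword_shift -{3}(cinfty_div s a 0) mul0n.
  rewrite subE; apply: SortingTake; last first.
    by rewrite /reduced -subE pE.
  apply: (IH _ (s * w)%g).
  - by move: pn; rewrite qE size_rcons /= size_map; lia.
  - by rewrite rcons_uniq.
  - by move=> r; rewrite mem_rcons => /saS.
  - apply/sorting_positions_take => //; last by rewrite -qE.
    by rewrite subE in pr; exists (subword (rcons a s) q) => //; apply: reduced_word_cons.
  by apply/nested_take; rewrite -qE.
have /andP[sa aU] := saU.
have aS : {subset a <= S} by move=> r ra; rewrite saS // inE ra orbT.
have mod0 j : j \in p -> (j %% (size a).+1 != 0)%N.
  move=> jp; apply/eqP => j0; move: jp; rewrite (divn_eq j (size a).+1) j0 addn0.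
  elim: (j %/ _)%N => [|k IHk]; first by rewrite mul0n; apply/negP.
  by rewrite mulSn addnC => /pnest.
have sp : s \notin subword (s :: a) p.
  apply/negP => /mapP[j jp sE]; have /negP := mod0 j jp; apply.
  have : nth 1%g (s :: a) (j %% (size a).+1) = nth 1%g (s :: a) 0 by [].
  by move/eqP; rewrite nth_uniq //= ltn_pmod.
have [a0|a0] := posnP (size a).
  have p_nil : p = [::].
    case: p mod0 {pn pw pnest p0 pso pr pmin pS pE sp} => // j p /(_ j (mem_head _ _)).
    by rewrite a0 modn1.
  rewrite p_nil (size0nil a0); apply: SortingSkip; exact: SortingNil.
have pq : p = map (skip (size a)) (map (unskip (size a)) p).
  rewrite -map_comp -[LHS]map_id; apply/eq_in_map => j jp /=.
  by rewrite unskipK ?mod0.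
set q := map (unskip _) p in pq.
have qS : {subset subword a q <= S}.
  move=> r /mapP[i iq ->]; rewrite -(cinfty_skip s) //; apply: pS.
  by apply: map_f; rewrite pq map_f.
rewrite pq subword_skip //; apply: SortingSkip; apply: (IH _ w) => //.
- by rewrite /q size_map; move: pn; rewrite addSn.
- apply/(sorting_positions_skip (s := s)); rewrite -?pq // => v wv.
  apply: contra sp => sv.
  have /reduced_support : letters (subword (s :: a) p) \subset S by apply: lettersS.
  move/(_ _ _ _ wv); rewrite -in_letters; apply => //.
  by rewrite -pE; apply: wprod_gen => r rp; rewrite in_letters.
by apply/(nested_skip s) => //; rewrite -pq.
Qed.

Lemma sorting_positions_uniq a w p q :
  sorting_positions S a w p -> sorting_positions S a w q -> p = q.
Proof.
move=> [pr pmin] [qr qmin].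
by apply: (@le_anti _ (seqlexi nat)); rewrite pmin // qmin.
Qed.

Lemma sorting_wordE a u : uniq a -> {subset a <= S} -> sorting a u ->
  sorting_word S a (wprod u) = u.
Proof.
move=> aU aS /(sorting_has_positions aU aS)[p [pu puE _]].
rewrite /sorting_word (xget_unique _ pu) // => q qu.
exact: sorting_positions_uniq qu pu.
Qed.

Lemma sortableP a w : uniq a -> {subset a <= S} ->
  sortable S a w <-> exists2 u, sorting a u & w = wprod u.
Proof.
move=> aU aS; split=> [[p [pw pb]]|[u au ->]].
  have [[_ [[pS pE] _]] _] := pw; exists (subword a p); last by rewrite pE.
  by apply: positions_sorting pw _ => //; apply/blocks_nested.
have [p [pu puE pn]] := sorting_has_positions aU aS au.
exists p; split=> //; apply/blocks_nested => //.
by rewrite puE => r /(sorting_sub au)/aS.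
Qed.

Lemma clE a u : uniq a -> a =i S -> sorting a u ->
  cl S a (wprod u) = last_reflections a u.
Proof.
move=> aU aE au; have aS : {subset a <= S} by move=> r; rewrite aE.
have lE : letters a = S by apply/setP => r; rewrite in_letters aE.
by rewrite /cl sorting_wordE // /last_reflections lE.
Qed.

(** * Coxeter elements *)

(** If s were missing from [v], the product would lie in W_<s>; cancelling the other letters of [a]
    would put s itself there, against [reduced_support]. *)
Lemma mem_word_full a v s : uniq a -> a =i S -> s \in S ->
  word_of S (wprod a) v -> s \in v.
Proof.
move=> aU aE sS [vS vE]; apply/negP => sv; pose J := (S :\ s)%SET.
have JS : J \subset S := finset.subsetDl _ _.
have inJ u : {subset u <= S} -> s \notin u -> wprod u \in <<J>>%g.
  move=> uS su; apply: wprod_gen => r ru; rewrite !inE uS // andbT.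
  by apply: contraNneq su => <-.
have : wprod a \in <<J>>%g by rewrite -vE; apply: inJ => //; apply/negP.
have sa : s \in a by rewrite aE.
case/splitPr: sa aU aE => a1 a2 + aE.
rewrite cat_uniq /= negb_or => /and3P[_ /andP[sa1 _] /andP[sa2 _]].
rewrite big_cat big_cons /=.
have a1J : wprod a1 \in <<J>>%g by apply: inJ => // r ra; rewrite -aE mem_cat ra.
have a2J : wprod a2 \in <<J>>%g.
  by apply: inJ => // r ra; rewrite -aE mem_cat inE ra !orbT.
rewrite (groupMl _ a1J) (groupMr _ a2J) => sJ.
have sred : reduced_word S s [:: s].
  split; [exact: word_of1|move=> [|//] [_]].
  by rewrite big_nil => s1; move: oneNS; rewrite s1 sS.
have := reduced_support JS sJ sred; move/(_ s (mem_head _ _)).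
by rewrite !inE eqxx.
Qed.

Lemma reduced_full a : uniq a -> a =i S -> reduced a.
Proof.
move=> aU aE; have aS : {subset a <= S} by move=> r; rewrite aE.
split=> // v av; apply: uniq_leq_size => // s /aS sS.
exact: mem_word_full av.
Qed.

(** Every reduced word of c contains all of [S] by [mem_word_full] and has the length of a
    permutation of [S], so it is one. *)
Lemma coxeter_element_word c a : coxeter_element S c -> reduced_word S c a ->
  [/\ uniq a, a =i S & wprod a = c].
Proof.
move=> [u [ucr uS]] ac.
have uU : uniq u by rewrite (perm_uniq uS) enum_uniq.
have uE : u =i S by move=> r; rewrite (perm_mem uS) mem_enum.
have [[_ uc] umin] := ucr; have [[aS aE] amin] := ac.
have ua : {subset u <= a}.
  by move=> r; rewrite uE => rS; apply: (mem_word_full uU uE rS); rewrite uc; split.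
have aU : uniq a by apply: leq_size_uniq uU ua _; apply: amin; case: ucr.
by split=> // r; apply/idP/idP => [/aS//|]; rewrite -uE => /ua.
Qed.

(** Both relations satisfy axioms (i) and (ii): rotate until x is the leading negative simple root,
    where axiom (i) decides. *)
Lemma compat_rcompat compat a x y : compatibility S compat ->
  reach a x -> uniq a -> a =i S -> x \in Tge S S -> y \in Tge S S ->
  compat (wprod a) x y = rcompat a x y.
Proof.
move=> [_ compat_neg compat_rot] re.
elim: re y => [s a0|s a0 {}x _ IH] y aU aE xT yT.
  have cox : coxeter_element S (wprod (s :: a0)).
    exists (s :: a0); split; first exact: reduced_full.
    by apply: uniq_perm; rewrite ?enum_uniq // => r; rewrite mem_enum aE.
  have sS : s \in S by rewrite -aE mem_head.
  by rewrite compat_neg // (@rcompat_inr S).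
have cox : coxeter_element S (wprod (s :: a0)).
  exists (s :: a0); split; first exact: reduced_full.
  by apply: uniq_perm; rewrite ?enum_uniq // => r; rewrite mem_enum aE.
have sS : s \in S by rewrite -aE mem_head.
have lE : letters (s :: a0) = S by apply/setP => r; rewrite in_letters aE.
rewrite (compat_rot _ s) //; last by exists a0; apply: reduced_full.
rewrite rcompat_rot ?lE //; last by move=> r; rewrite aE.
have -> : (s * wprod (s :: a0) * s)%g = wprod (rcons a0 s).
  by rewrite -cats1 big_cat /= big_seq1 big_cons mulgA mulss // mul1g.
apply: IH; rewrite ?sigma_Tge ?rcons_uniq //.
by move=> r; rewrite mem_rcons aE.
Qed.

Lemma cluster_rcluster compat a C : compatibility S compat -> uniq a -> a =i S ->
  cluster S (compat (wprod a)) C <-> rcluster a C.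
Proof.
move=> compatP aU aE; have aS : {subset a <= S} by move=> r; rewrite aE.
have lE : letters a = S by apply/setP => r; rewrite in_letters aE.
suff /maxset_eq E : pairwise_compatible S (compat (wprod a)) =1
    compatible_in (letters a) (rcompat a) by rewrite /cluster /rcluster E.
move=> D; apply/idP/idP; rewrite /compatible_in lE => /compatible_inP[DT Dr];
  apply/compatible_inP; split=> // x y xD yD xy.
  rewrite -(@compat_rcompat compat) ?(fintype.subsetP DT) ?Dr //.
  by apply: reach_Tge; rewrite // lE (fintype.subsetP DT).
rewrite (@compat_rcompat compat) ?(fintype.subsetP DT) ?Dr //.
by apply: reach_Tge; rewrite // lE (fintype.subsetP DT).
Qed.

(** Elements -s of the set correspond to letters missing from [u], and [reduced_support] makes the
    support independent of the reduced word. *)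
Lemma full_supportP a u : uniq a -> a =i S -> sorting a u ->
  full_support S (wprod u) <-> positive S (last_reflections a u).
Proof.
move=> aU aE au; have aS : {subset a <= S} by move=> r; rewrite aE.
have uS : {subset u <= S} by move=> r /(sorting_sub au)/aS.
split=> [[v [vu vS]] s sS|pos].
  rewrite inr_last_reflections ?aE // negbK -in_letters.
  have uG : wprod u \in <<letters u>>%g by apply: wprod_gen => r; rewrite in_letters.
  by apply: (reduced_support (lettersS uS) uG vu); rewrite vS.
exists u; split; first exact: sorting_reduced au.
move=> r; apply/idP/idP => [/uS//|rS].
by have := pos r rS; rewrite inr_last_reflections ?aE // negbK.
Qed.

Lemma cl_bij compat c a : compatibility S compat ->
  coxeter_element S c -> reduced_word S c a ->
  set_bij (sortable S a) (cluster S (compat c)) (cl S a) /\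
  set_bij (sortable S a `&` full_support S)%classic
          (cluster S (compat c) `&` positive S)%classic (cl S a).
Proof.
move=> compatP cox ac; have [aU aE <-] := coxeter_element_word cox ac.
have aS : {subset a <= S} by move=> r; rewrite aE.
have toC w : sortable S a w -> cluster S (compat (wprod a)) (cl S a w).
  case/(sortableP _ aU aS) => u au ->; rewrite clE //.
  by apply/cluster_rcluster => //; apply: sorting_rcluster.
have inj v w : sortable S a v -> sortable S a w -> cl S a v = cl S a w -> v = w.
  case/(sortableP _ aU aS) => u au -> /(sortableP _ aU aS)[u' au' ->].
  by rewrite !clE // => /(last_reflections_inj aU aS au au') ->.
have surj C : cluster S (compat (wprod a)) C -> exists2 w, sortable S a w & cl S a w = C.
  move/cluster_rcluster => /(_ compatP aU aE) /(rcluster_surj aU aS)[u au <-].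
  by exists (wprod u); [apply/sortableP => //; exists u|rewrite clE].
have supp w : sortable S a w -> full_support S w <-> positive S (cl S a w).
  by case/(sortableP _ aU aS) => u au ->; rewrite clE //; apply: full_supportP.
split; split.
- exact: toC.
- by move=> v w /set_mem vs /set_mem ws; apply: inj.
- by move=> C /surj[w ws <-]; exists w.
- by move=> w [ws wf]; split; [apply: toC|apply/supp].
- by move=> v w /set_mem[vs _] /set_mem[ws _]; apply: inj.
by move=> C [/surj[w ws <-] Cp]; exists w => //; split=> //; apply/supp.
Qed.

End GeometricRepresentation.

Theorem theorem8p1 (gT : finGroupType) (S : {set gT})
  (compat : gT -> rel (gT + gT)) (c : gT) (a : seq gT) :
  coxeter_system S -> compatibility S compat ->
  coxeter_element S c -> reduced_word S c a ->
  set_bij (sortable S a) (cluster S (compat c)) (cl S a) /\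
  set_bij (sortable S a `&` full_support S)%classic
          (cluster S (compat c) `&` positive S)%classic (cl S a).
Proof. by move=> coxS; apply: (@cl_bij Rdefinitions.R gT S coxS). Qed.
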